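(* Let $t\ge 1$ and $d\ge 1$ be integers. Define \[ N_{t,d}:=\begin{cases}\displaystyle\binom{d+m}{d}+\binom{d+m-1}{d} & \text{if } t=2m,\\[8pt] \displaystyle 2\binom{d+m}{d} & \text{if } t=2m+1,\end{cases} \] let $A_{t,d}$ denote the sum of the first $N_{t,d}-1$ terms of the sequence \[ 1,1,4,4,9,9,\ldots,n^2,n^2,\ldots, \] and define \[ B_{t,d}:=\begin{cases}\displaystyle\frac{m(d+m)}{d+2}\bigg(\binom{d+m}{d}+\binom{d+m-1}{d}\bigg) & \text{if } t=2m,\\[12pt] \displaystyle\binom{d+m}{d}\bigg(1+\frac{2m(d+m+1)}{d+2}\bigg) & \text{if } t=2m+1,\end{cases} \] where $m$ is an integer. Then every spherical $t$-design curve $\gamma$ in $S^d$ has length \[ L(\gamma)\ \ge\ 2\pi\cdot\sqrt{\frac{A_{t,d}}{B_{t,d}}}. \]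
   Context: $S^d$ is the unit sphere in $\mathbb{R}^{d+1}$, $\sigma$ is the uniform (rotation-invariant) probability measure on $S^d$, and $\Pi_d^t$ is the vector space of restrictions to $S^d$ of real polynomials on $\mathbb{R}^{d+1}$ of degree at most $t$. Let $\gamma\colon[0,2\pi)\to S^d$ be a Lipschitz parameterization of a closed rectifiable curve (closed: $\gamma(\theta)\to\gamma(0)$ as $\theta\to 2\pi^-$), with arclength $L(\gamma):=\int_0^{2\pi}\|\gamma'(\theta)\|\,d\theta$ (positive, so that the following formula makes sense). The curve $\gamma$ is a spherical $t$-design curve (or $t$-design curve) in $S^d$ if for all $f\in\Pi_d^t$, \[ \int_{S^d}f(x)\,d\sigma(x)=\frac{1}{L(\gamma)}\int_0^{2\pi}f(\gamma(\theta))\,\|\gamma'(\theta)\|\,d\theta. \] *)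

(* Defs.v *)
From mathcomp Require Import all_boot all_order all_algebra.
From mathcomp.multinomials Require mpoly.
(* mpoly's notations clash with those of MathComp-Analysis. *)
Import -(notations) mpoly.
From mathcomp Require Import all_classical all_reals all_analysis.

Set Implicit Arguments.
Unset Strict Implicit.
Unset Printing Implicit Defensive.

Import Order.TTheory GRing.Theory Num.Theory.
Import numFieldNormedType.Exports.

Local Open Scope classical_set_scope.
Local Open Scope ring_scope.

(* The norm `|v| that MathComp-Analysis puts on row vectors is the sup norm,
   hence a separate Euclidean norm. *)
Definition enorm (R : realType) (n : nat) (v : 'rV[R]_n) : R :=
  Num.sqrt (\sum_(i < n) v 0 i ^+ 2).

(* S^d, in the row vectors of length d + 1. *)
Definition sphere (R : realType) (d : nat) : set 'rV[R]_d.+1 :=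
  [set x | enorm x = 1].
Arguments sphere : clear implicits.

(* R^(d+1) with its Borel sigma-algebra. *)
Notation borel_rV R d := (g_sigma_algebraType (@open 'rV[R]_d.+1)).

(* sigma is represented as a Borel probability on R^(d+1) carried by S^d.  For
   1 <= d this property determines sigma. *)
Definition is_uniform_sphere (R : realType) (d : nat)
    (sigma : probability (borel_rV R d) R) : Prop :=
  sigma (sphere R d : set (borel_rV R d)) = 1%E /\
  (forall Q : 'M[R]_d.+1, Q *m Q^T = 1%:M ->
   forall A : set (borel_rV R d), measurable A ->
     sigma [set x : borel_rV R d | A (x *m Q : 'rV[R]_d.+1)] = sigma A).

(* Membership in Pi_d^t of the restriction of f to S^d; the values of f off the
   sphere are irrelevant.  Note that msize is the degree plus one. *)
Definition sphere_poly (R : realType) (d t : nat) (f : 'rV[R]_d.+1 -> R) :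
    Prop :=
  exists2 p : mpoly.mpoly d.+1 R, (mpoly.msize p <= t.+1)%N &
    forall x, sphere R d x -> f x = mpoly.meval (fun i => x 0 i) p.

(* A curve [0, 2 pi) -> S^d is a function on R whose values outside of
   [0, 2 pi) are irrelevant. *)
Definition speed (R : realType) (d : nat) (gamma : R -> 'rV[R]_d.+1)
    (theta : R) : R := enorm (derive1 gamma theta).

Definition curve_length (R : realType) (d : nat) (gamma : R -> 'rV[R]_d.+1) :
    R :=
  (\int[lebesgue_measure]_(theta in `[0%R, (2 * pi)%R[) speed gamma theta)%R.

Definition closed_lipschitz_curve (R : realType) (d : nat)
    (gamma : R -> 'rV[R]_d.+1) : Prop :=
  [/\ forall theta, theta \in `[0, 2 * pi[ -> sphere R d (gamma theta),
      exists K : R, forall a b, a \in `[0, 2 * pi[ -> b \in `[0, 2 * pi[ ->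
        enorm (gamma a - gamma b) <= K * `|a - b|,
      gamma theta @[theta --> (2 * pi)^'-] --> gamma 0 &
      0 < curve_length gamma].

Definition design_curve (R : realType) (d : nat)
    (sigma : probability (borel_rV R d) R) (t : nat)
    (gamma : R -> 'rV[R]_d.+1) : Prop :=
  closed_lipschitz_curve gamma /\
  forall f : 'rV[R]_d.+1 -> R, sphere_poly t f ->
    (\int[sigma]_(x in (sphere R d : set (borel_rV R d))) f x)%R =
    (curve_length gamma)^-1 *
    (\int[lebesgue_measure]_(theta in `[0%R, (2 * pi)%R[)
       (f (gamma theta) * speed gamma theta))%R.

Definition Ntd (t d : nat) : nat :=
  let m := t./2 in
  if odd t then 2 * 'C(d + m, d) else 'C(d + m, d) + 'C(d + m - 1, d).

(* i./2.+1 squared, for i = 0, 1, 2, ..., is 1, 1, 4, 4, 9, 9, ... *)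
Definition Atd (t d : nat) : nat := \sum_(i < (Ntd t d).-1) (i./2.+1 ^ 2).

Definition Btd (R : realType) (t d : nat) : R :=
  let m := t./2 in
  if odd t then
    'C(d + m, d)%:R * (1 + (2 * m * (d + m + 1))%:R / (d + 2)%:R)
  else
    (m * (d + m))%:R / (d + 2)%:R * ('C(d + m, d) + 'C(d + m - 1, d))%:R.
Arguments Btd : clear implicits.

(* Main.v *)
(* Let [f_a] be an orthonormal basis of the homogeneous polynomials of degree m.
   For odd t = 2m + 1 add the products [f_a * x_c] with the coordinates, and for
   t = 2m add an orthonormal basis in degree m - 1.  By the design property the two
   families restrict to functions on the curve that, with respect to arclength, are
   orthogonal to each other (their products are odd) and orthonormal, except that
   for the [f_a * x_c] there is only Bessel's inequality; together their squares
   integrate to [Ntd].  So against any orthonormal system on the circle the squared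
   coefficients of these features add up to at most 1 in each mode and to [Ntd] in
   total, and the energy of the features is at least the sum of the [Ntd] lowest
   eigenvalues of the Laplacian of the circle of length L, (2 pi / L)^2 [Atd].  By
   rotation invariance the squared derivatives of the features along a unit tangent
   vector add up to the constant [Btd], which is therefore the energy.

   The curve is only Lipschitz, so the spectral argument is carried out on M points
   equally spaced in arclength, with the Laplacian of the M-cycle; the quadrature
   error is O(1 / M), and M tends to infinity at the end. *)

(* The degrees are chosen so that a product of two features from different families has the odd
   degree 2m - 1 or 2m + 1, which is at most t: its mean over the sphere vanishes by x -> -x, and so
   does its mean over the curve. For odd t the product of two features [f_a * x_c] has degree t + 1,
   out of reach of the design property, which is why only Bessel's inequality remains. It suffices
   because the squares of the x_c add up to 1 at every point, which brings the degree back to 2m.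
   The lowest eigenvalue of the circle is 0, so only [Ntd - 1] of the [Ntd] lowest ones contribute
   to [Atd]. The basis consists of all forms of a given degree, not of harmonic ones. Its energy is
   found from a trace, which does not depend on the basis and can be read off from the monomials
   although these are not orthogonal. Sampling spoils the orthogonality relations by O(1 / M), the
   [delta] of the discrete lemmas, whereas the pointwise identities on the sphere, such as the sum
   of the squared features being [Ntd], stay exact at every sample. *)
From HB Require Import structures.
Require Import Defs.
From mathcomp Require Import all_boot all_order all_algebra.
From mathcomp Require Import ring lra zify.
From mathcomp.multinomials Require mpoly.

Set Implicit Arguments.
Unset Strict Implicit.
Unset Printing Implicit Defensive.

Import Order.TTheory GRing.Theory Num.Theory.

(** * Homogeneous polynomials *)

Section MonomialCounts.
Import mpoly.
Local Open Scope nat_scope.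

Definition mons (n k : nat) : seq 'X_{1..n} :=
  [seq s2m (val t) | t <- enum (basis n k)].

Lemma mem_mons n k (a : 'X_{1..n}) : (a \in mons n k) = (mdeg a == k).
Proof. by rewrite basis_cover. Qed.

Lemma size_mons n k : size (mons n.+1 k) = 'C(k + n, n).
Proof. by rewrite size_basis -[in RHS]bin_sub ?leq_addl // addnK. Qed.

Lemma uniq_mons n k : uniq (mons n k).
Proof. exact: uniq_basis. Qed.

Lemma sum_mons_shift n k (i : 'I_n) (h : 'X_{1..n} -> nat) :
  \sum_(a <- mons n k.+1 | 0 < a i) h a = \sum_(b <- mons n k) h (b + U_(i))%MM.
Proof.
rewrite -big_filter -(big_map (fun b => (b + U_(i))%MM) xpredT h).
apply: perm_big; apply: uniq_perm.
- exact/filter_uniq/uniq_mons.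
- by rewrite map_inj_uniq ?uniq_mons // => x y; apply: addIm.
move=> a; rewrite mem_filter mem_mons; apply/andP/mapP => [[ai /eqP da]|[b]].
  exists (a - U_(i))%MM; last first.
    by rewrite submK // lep1mP -lt0n.
  have e : ((a - U_(i)) + U_(i))%MM = a by rewrite submK // lep1mP -lt0n.
  by rewrite mem_mons -eqSS -da -{2}e mdegD mdeg1 addn1.
rewrite mem_mons => /eqP db ->; rewrite mnmDE mnm1E eqxx addn1.
by rewrite mdegD mdeg1 addn1 db.
Qed.

(** A recursion in the degree: terms with exponent 0 vanish, the others come from degree [k] by
    multiplication with the [i]-th variable. The exponent is a separate argument of [h] so that it
    turns into a visible successor. *)
Lemma sum_mons_dep n k (i : 'I_n) (h : nat -> 'X_{1..n} -> nat) :
  (forall a, h 0 a = 0) ->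
  \sum_(a <- mons n k.+1) h (a i) a =
  \sum_(b <- mons n k) h (b i).+1 (b + U_(i))%MM.
Proof.
move=> h0; rewrite (bigID (fun a : 'X_{1..n} => 0 < a i)) /=.
rewrite [X in _ + X]big1 ?addn0; last first.
  by move=> a; rewrite -eqn0Ngt => /eqP ->.
rewrite sum_mons_shift; apply: eq_bigr => b _.
by rewrite mnmDE mnm1E eqxx addn1.
Qed.

Lemma sum_mons_coord n k (i : 'I_n.+1) :
  \sum_(a <- mons n.+1 k) (a i).+1 = 'C(k + n.+1, n.+1).
Proof.
elim: k => [|k IH].
  rewrite add0n binn; have -> : mons n.+1 0 = [:: 0%MM].
    apply: perm_small_eq => //; apply: uniq_perm => //; first exact: uniq_mons.
    by move=> a; rewrite mem_mons mdeg_eq0 inE.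
  by rewrite big_seq1 mnm0E.
have -> : \sum_(a <- mons n.+1 k.+1) (a i).+1 =
    \sum_(a <- mons n.+1 k.+1) a i + size (mons n.+1 k.+1).
  rewrite -sum1_size -big_split /=; apply: eq_bigr => a _; exact/esym/addn1.
rewrite (@sum_mons_dep _ _ i (fun c _ => c)) // IH size_mons.
by rewrite !addSn binS addnS.
Qed.

(** The recursion of [sum_mons_dep] becomes Pascal's rule. Sums of this form are the diagonal
    entries in [mcoeff_rotgen2], added up in [tr_Lam2]. *)
Lemma sum_mons_coord2 n k (i j : 'I_n.+1) : i != j ->
  \sum_(a <- mons n.+1 k) a i * (a j).+1 = 'C(k + n.+1, n.+2).
Proof.
move=> ij; elim: k => [|k IH].
  rewrite add0n bin_small // big1_seq // => a /andP[_].
  by rewrite mem_mons mdeg_eq0 => /eqP ->; rewrite mnm0E.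
rewrite (@sum_mons_dep _ _ i (fun c a => c * (a j).+1)) //.
under eq_bigr => b _.
  rewrite mnmDE mnm1E (negbTE ij) addn0 mulSn addnC; over.
by rewrite big_split /= IH sum_mons_coord addSn binS.
Qed.

End MonomialCounts.

Lemma digits_inj (B n : nat) (a b : 'I_n -> nat) :
  (forall i, a i < B)%N -> (forall i, b i < B)%N ->
  (\sum_i a i * B ^ i = \sum_i b i * B ^ i)%N -> a =1 b.
Proof.
elim: n a b => [|n IH] a b aB bB; first by move=> _ [].
have B0 : (0 < B)%N by apply: leq_ltn_trans (aB ord0).
have shift (c : 'I_n.+1 -> nat) : (\sum_i c i * B ^ i =
    (\sum_(i < n) c (lift ord0 i) * B ^ i) * B + c ord0)%N.
  rewrite big_ord_recl expn0 muln1 addnC; congr (_ + _)%N.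
  rewrite big_distrl /=; apply: eq_bigr => i _.
  by rewrite /bump /= add1n expnSr mulnA.
rewrite !shift => e.
have e0 : a ord0 = b ord0.
  by have := congr1 (modn^~ B) e; rewrite !modnMDl !modn_small.
move: e; rewrite e0 => /addIn /eqP; rewrite eqn_pmul2r // => /eqP e.
move=> i; case: (unliftP ord0 i) => [j|] -> //.
exact: (IH (fun j => a (lift ord0 j)) (fun j => b (lift ord0 j))).
Qed.

Section HomogeneousPolynomials.
Import mpoly.
Local Open Scope ring_scope.
Context {R : numDomainType} {n : nat}.
Implicit Types p q : {mpoly R[n]}.

(* Kronecker substitution [x_i := u ^ (B ^ i)], with [B] larger than all the
   exponents, reduces this to univariate polynomials. *)
Lemma mpoly_fun_eq0 p : (forall x : 'I_n -> R, p.@[x] = 0) -> p = 0.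
Proof.
move=> p0; pose B := msize p; pose w (m : 'X_{1..n}) := (\sum_i m i * B ^ i)%N.
pose P : {poly R} := \sum_(m <- msupp p) p@_m *: 'X^(w m).
have hP u : P.[u] = 0.
  rewrite -(p0 (fun i => u ^+ (B ^ i))) mevalE horner_sum.
  apply: eq_bigr => m _; rewrite hornerZ hornerXn; congr (_ * _).
  by rewrite /w -prodrXr; apply: eq_bigr => i _; rewrite -exprM mulnC.
have P0 : P = 0.
  apply/eqP/negPn/negP => Pn0.
  pose rs := [seq (i%:R : R) | i <- iota 0 (size P)].
  have : (size rs < size P)%N.
    apply: max_poly_roots => //; last first.
      rewrite map_inj_uniq ?iota_uniq // => i j /eqP.
      by rewrite eqr_nat => /eqP.
    by apply/allP => u _; apply/rootP; exact: hP.
  by rewrite size_map size_iota ltnn.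
have bnd m i : m \in msupp p -> (m i < B)%N.
  move=> /msize_mdeg_lt; apply: leq_ltn_trans.
  by rewrite mdegE (bigD1 i) //= leq_addr.
apply/mpolyP => m; rewrite mcoeff0.
have [mp|/memN_msupp_eq0 //] := boolP (m \in msupp p).
have : P`_(w m) = 0 by rewrite P0 coef0.
rewrite coef_sum (bigD1_seq m) //= coefZ coefXn eqxx mulr1.
rewrite big_seq_cond big1 ?addr0 // => k /andP[kp km].
rewrite coefZ coefXn; case: eqP => [e|]; rewrite ?mulr0 //.
case/negP: km; apply/eqP/mnmP/(@digits_inj B) => // i; exact: bnd.
Qed.

Lemma homog_span k p : p \is ishomog1 k mdeg ->
  p = \sum_(a <- mons n k) p@_a *: 'X_[a].
Proof.
move=> hp; apply/mpolyP => m; rewrite raddf_sum /=.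
under eq_bigr do rewrite mcoeffZ mcoeffX.
have [mk|mk] := boolP (m \in mons n k).
  rewrite (bigD1_seq m) ?uniq_mons //= eqxx mulr1 big1 ?addr0 // => a am.
  by rewrite (negbTE am) mulr0.
rewrite big1_seq => [|a /andP[_ ak]].
  by rewrite (dhomog_nemf_coeff hp) // -mem_mons.
by case: eqP => [am|]; rewrite ?mulr0 //; rewrite -am ak in mk.
Qed.

Lemma homog_prodX (F : 'I_n -> {mpoly R[n]}) (a : 'X_{1..n}) :
  (forall i, F i \is ishomog1 1 mdeg) ->
  \prod_i F i ^+ a i \is ishomog1 (mdeg a) mdeg.
Proof.
move=> hF; rewrite mdegE.
apply: (big_rec2 (fun k p => p \is ishomog1 k mdeg)); first exact: dhomog1.
move=> i k p _ hp; apply: dhomogM => //; rewrite -[X in ishomog1 X _]mul1n.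
exact: dhomogMn.
Qed.

Lemma homog_linear_subst k p (Q : 'M[R]_n) : p \is ishomog1 k mdeg ->
  exists2 q, q \is ishomog1 k mdeg &
    forall x : 'I_n -> R, p.@[fun i => \sum_j x j * Q j i] = q.@[x].
Proof.
move=> hp; pose F i : {mpoly R[n]} := \sum_j Q j i *: 'X_j.
exists (\sum_(a <- mons n k) p@_a *: \prod_i F i ^+ a i).
  rewrite big_seq; apply: rpred_sum => a; rewrite mem_mons => /eqP <-.
  apply: rpredZ; apply: homog_prodX => i; apply: rpred_sum => j _.
  by apply: rpredZ; rewrite dhomogX; apply/eqP/mdeg1.
move=> x; rewrite {1}(homog_span hp) !raddf_sum /=; apply: eq_bigr => a _.
rewrite !mevalZ mevalX (rmorph_prod (meval x)); congr (_ * _).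
apply: eq_bigr => i _; rewrite rmorphXn /=; congr (_ ^+ _).
rewrite raddf_sum /=; apply: eq_bigr => j _.
by rewrite mevalZ mevalXU mulrC.
Qed.

(** The infinitesimal rotation in the plane of two coordinates, acting on polynomials. *)
Definition rotgen (i j : 'I_n) p : {mpoly R[n]} :=
  'X_i * p^`M(j) - 'X_j * p^`M(i).

Lemma rotgen_sum i j I (r : seq I) (P : pred I) (F : I -> {mpoly R[n]}) :
  rotgen i j (\sum_(k <- r | P k) F k) = \sum_(k <- r | P k) rotgen i j (F k).
Proof.
apply: (big_morph (rotgen i j)) => [p q|]; rewrite /rotgen.
  by rewrite !mderivD !mulrDr opprD addrACA.
by rewrite !mderiv0 !mulr0 subrr.
Qed.

Lemma rotgenZ i j c p : rotgen i j (c *: p) = c *: rotgen i j p.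
Proof. by rewrite /rotgen !mderivZ -!mul_mpolyC; ring. Qed.

(** Where the subtraction of exponents is truncated, the coefficient in front is zero. *)
Lemma rotgenX i j a : rotgen i j 'X_[a] =
  (a j)%:R *: 'X_[U_(i) + (a - U_(j))] - (a i)%:R *: 'X_[U_(j) + (a - U_(i))].
Proof. by rewrite /rotgen !mderivX !mpolyXD -!mul_mpolyC; ring. Qed.

Lemma homog_rotgenX i j a : rotgen i j 'X_[a] \is ishomog1 (mdeg a) mdeg.
Proof.
have hom u v : (a u)%:R *: 'X_[R, U_(v) + (a - U_(u))] \is
    ishomog1 (mdeg a) mdeg.
  have [->|a0] := eqVneq (a u) 0%N; first by rewrite scale0r rpred0.
  have e : (U_(u) + (a - U_(u)))%MM = a by rewrite addmC submK ?lep1mP.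
  by apply: dhomogZ; rewrite dhomogX /= -[in X in _ == X]e !mdegD !mdeg1.
by rewrite rotgenX; apply: rpredB; exact: hom.
Qed.

(** One application moves a unit of exponent from [j] to [i] or back. Only the two round trips
    return to [a], each with a negative sign; two moves in the same direction never do. *)
Lemma mcoeff_rotgen2 i j a : i != j -> (rotgen i j (rotgen i j 'X_[a]))@_a =
  - (a i * (a j).+1 + a j * (a i).+1)%N%:R.
Proof.
move=> ij.
have coef u v : u != v -> a v != 0%N ->
    (rotgen u v 'X_[U_(u) + (a - U_(v))])@_a = - (a u).+1%:R.
  move=> uv av; rewrite rotgenX mcoeffB !mcoeffZ !mcoeffX.
  have -> : (U_(v) + ((U_(u) + (a - U_(v))) - U_(u)) == a)%MM.
    apply/eqP/mnmP => k; rewrite !mnmE; case: eqP => [<-|] //=.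
      by move: uv av; case: (u == v) => //; lia.
    by lia.
  have /negbTE -> : (U_(u) + ((U_(u) + (a - U_(v))) - U_(v)) != a)%MM.
    apply/eqP => /mnmP /(_ u); rewrite !mnmE eqxx eq_sym (negbTE uv) /=; lia.
  rewrite !mnmE eqxx mulr0 mulr1 sub0r eq_sym (negbTE uv) subn0.
  by rewrite eqxx.
have skew u v p : rotgen u v p = - rotgen v u p by rewrite /rotgen opprB.
rewrite [rotgen i j 'X_[_]]rotgenX.
have -> p q : rotgen i j (p - q) = rotgen i j p - rotgen i j q.
  by rewrite /rotgen !mderivB !mulrBr; ring.
rewrite !rotgenZ mcoeffB !mcoeffZ.
rewrite natrD opprD addrC; congr (_ + _).
  have [->|ai] := eqVneq (a i) 0%N; first by rewrite mul0r mul0n oppr0.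
  rewrite skew mcoeffN coef // 1?eq_sym //; by rewrite natrM opprK.
have [->|aj] := eqVneq (a j) 0%N; first by rewrite mul0r mul0n oppr0.
by rewrite coef // natrM mulrN.
Qed.

End HomogeneousPolynomials.

Local Open Scope ring_scope.

(** Gram-Schmidt in matrix form: split off the first coordinate and continue with the Schur
    complement of the leading entry. *)
Lemma posdef_orthonormalization (R : rcfType) (N : nat) (M : 'M[R]_N) :
  M^T = M -> (forall u : 'rV_N, u != 0 -> 0 < (u *m M *m u^T) 0 0) ->
  exists G : 'M_N, G *m M *m G^T = 1%:M.
Proof.
elim: N M => [|N IH] M symM posM; first by exists 0; rewrite flatmx0 [RHS]flatmx0.
pose M' : 'M_(1 + N) := M.
have posM' (u : 'rV_(1 + N)) : u != 0 -> 0 < (u *m M' *m u^T) 0 0.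
  exact: posM.
pose s := M 0 0; pose b : 'rV_N := ursubmx M'; pose C : 'M_N := drsubmx M'.
have eul : ulsubmx M' = s%:M.
  by rewrite [LHS]mx11_scalar !mxE; congr (M _ _)%:M; apply/val_inj.
have edl : dlsubmx M' = b^T by rewrite trmx_ursub [M'^T]symM.
have eM : M' = block_mx s%:M b b^T C by rewrite -eul -edl submxK.
have symC : C^T = C by rewrite trmx_drsub [M'^T]symM.
have s0 : 0 < s.
  have := posM (delta_mx 0 0); rewrite -rowE trmx_delta -colE !mxE; apply.
  by apply/eqP => /matrixP /(_ 0 0)/eqP; rewrite !mxE oner_eq0.
pose S := C - s^-1 *: (b^T *m b).
have [||G' hG'] := IH S.
- by rewrite /S linearB /= linearZ /= trmx_mul trmxK symC.
(* The first entry of [u] minimizes the form of [M'] over all vectors with tail [v]; the minimum is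
   the value of the Schur complement at [v]. *)
- move=> v v0; pose u : 'rV_(1 + N) := row_mx (- s^-1 *: (v *m b^T)) v.
  have u0 : u != 0.
    apply: contra_neq v0 => u0; have := congr1 rsubmx u0.
    by rewrite row_mxKr linear0.
  have := posM' u u0; rewrite eM /u mul_row_block tr_row_mx mul_row_col.
  rewrite mul_mx_scalar scalerA mulrN divff ?gt_eqF // scaleN1r addNr mul0mx.
  rewrite add0r /S mulmxBr -!scalemxAr -!scalemxAl !mulmxA.
  by rewrite scaleNr addrC.
pose G : 'M_(1 + N) :=
  block_mx (Num.sqrt s)^-1%:M 0 (- s^-1 *: (G' *m b^T)) G'.
suff : G *m M' *m G^T = 1%:M by exists G.
have ss : s = Num.sqrt s * Num.sqrt s by rewrite -expr2 sqr_sqrtr // ltW.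
have q0 : Num.sqrt s != 0 by rewrite gt_eqF // sqrtr_gt0.
rewrite eM /G mulmx_block tr_block_mx mulmx_block.
rewrite !mul0mx !addr0 trmx0 tr_scalar_mx !mulmx0 !addr0.
have e1 : - s^-1 *: (G' *m b^T) *m s%:M + G' *m b^T = 0.
  by rewrite mul_mx_scalar scalerA mulrN divff ?gt_eqF // scaleN1r addNr.
rewrite e1 !mul0mx add0r [RHS](scalar_mx_block 1 N); congr block_mx.
- by rewrite -!scalar_mxM; congr _%:M; rewrite {2}ss; field.
- rewrite linearZ /= trmx_mul trmxK -scalar_mxM !mul_scalar_mx.
  rewrite -scalemxAl scalerA -scalerDl; apply/eqP.
  rewrite scaler_eq0; apply/orP; left; apply/eqP.
  by rewrite mulrN -mulrA mulfV ?gt_eqF // mulr1 addNr.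
- rewrite -[RHS]hG' /S.
  by rewrite mulmxBr -scalemxAr mulmxA -scalemxAl scaleNr addrC.
Qed.

Import -(notations) mpoly.
From mathcomp Require Import finmap all_classical all_reals all_analysis.
From mathcomp Require Import measurable_realfun.
Import numFieldNormedType.Exports.

Local Open Scope classical_set_scope.
Local Open Scope ring_scope.

(** * Evaluation and directional derivatives of polynomials *)

Section PolynomialCalculus.
Context {R : realType} {n : nat}.
Implicit Types (p q : mpoly n R) (x v : 'rV[R]_n).

Definition pev p x : R := meval (fun i => x 0 i) p.

Definition dird p x v : R := \sum_i v 0 i * pev (mderiv i p) x.

Lemma pevD p q x : pev (p + q) x = pev p x + pev q x.
Proof. exact: mevalD. Qed.

Lemma pevM p q x : pev (p * q) x = pev p x * pev q x.
Proof. exact: mevalM. Qed.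

Lemma pevZ c p x : pev (c *: p) x = c * pev p x.
Proof. exact: mevalZ. Qed.

Lemma pev1 x : pev 1 x = 1.
Proof. exact: meval1. Qed.

Lemma pev_sum (I : Type) (r : seq I) (P : pred I) (F : I -> mpoly n R) x :
  pev (\sum_(i <- r | P i) F i) x = \sum_(i <- r | P i) pev (F i) x.
Proof. exact: raddf_sum. Qed.

Lemma pevX (i : 'I_n) x : pev (mpolyX R (mnm1 i)) x = x 0 i.
Proof. exact: mevalXU. Qed.

Lemma dirdD p q x v : dird (p + q) x v = dird p x v + dird q x v.
Proof.
rewrite /dird -big_split; apply: eq_bigr => i _.
by rewrite mderivD pevD mulrDr.
Qed.

Lemma dirdZ c p x v : dird (c *: p) x v = c * dird p x v.
Proof.
rewrite /dird big_distrr; apply: eq_bigr => i _ /=.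
by rewrite mderivZ pevZ mulrCA.
Qed.

Lemma dirdM p q x v :
  dird (p * q) x v = dird p x v * pev q x + pev p x * dird q x v.
Proof.
rewrite /dird big_distrl big_distrr -big_split; apply: eq_bigr => i _ /=.
by rewrite mderivM pevD !pevM; ring.
Qed.

Lemma dirdC c x v : dird (mpolyC n c) x v = 0.
Proof.
by rewrite /dird big1 // => i _; rewrite mderivC /pev meval0 mulr0.
Qed.

Lemma dird1 x v : dird 1 x v = 0.
Proof. exact: dirdC. Qed.

Lemma dirdX (j : 'I_n) x v : dird (mpolyX R (mnm1 j)) x v = v 0 j.
Proof.
rewrite /dird (bigD1 j) //= big1 ?addr0 => [|i ij]; rewrite mderivX mnm1E.
  have -> : mnm_sub (mnm1 j) (mnm1 j) = mnm0.
    by apply/mnmP => k; rewrite mnmBE subnn mnm0E.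
  by rewrite eqxx scale1r mpolyX0 pev1 mulr1.
by rewrite eq_sym (negbTE ij) scale0r /pev meval0 mulr0.
Qed.

Lemma dird_sum (I : Type) (r : seq I) (P : pred I) (F : I -> mpoly n R) x v :
  dird (\sum_(i <- r | P i) F i) x v = \sum_(i <- r | P i) dird (F i) x v.
Proof.
apply: (big_morph (fun p => dird p x v)) => [p q|]; first exact: dirdD.
by rewrite -[0]mpolyC0 dirdC.
Qed.

Lemma dird_scale c p x v : dird p x (c *: v) = c * dird p x v.
Proof.
by rewrite /dird big_distrr; apply: eq_bigr => i _ /=; rewrite mxE mulrA.
Qed.

Lemma mpoly_ring_ind (P : mpoly n R -> Prop) :
  (forall c, P (mpolyC n c)) -> (forall i, P (mpolyX R (mnm1 i))) ->
  (forall p q, P p -> P q -> P (p + q)) ->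
  (forall p q, P p -> P q -> P (p * q)) -> forall p, P p.
Proof.
move=> PC PX PD PM p; rewrite [p]mpolyE.
apply: (big_ind P) => [||m _]; [by rewrite -mpolyC0|exact: PD|].
rewrite -mul_mpolyC; apply: (PM) => //; rewrite mpolyXE_id.
apply: (big_ind P) => [||i _]; [by rewrite -mpolyC1|exact: (PM)|].
by elim: (m i) => [|k IH]; rewrite ?expr0 -?mpolyC1 // exprS; apply: (PM).
Qed.

(** The chain rule, with differentiability required of each coordinate separately: this is the form
    in which the Lipschitz curve provides it. *)
Lemma is_derive_pev p (c : R -> 'rV[R]_n) (t : R) v :
  (forall i, is_derive t 1 (fun s => c s 0 i) (v 0 i)) ->
  is_derive t 1 (fun s => pev p (c s)) (dird p (c t) v).
Proof.
move=> dc; elim/mpoly_ring_ind: p => [a|i|p q dp dq|p q dp dq].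
- rewrite dirdC (_ : (fun s => _) = cst a); first exact: is_derive_cst.
  by apply/funext => s; rewrite /pev mevalC.
- rewrite dirdX (_ : (fun s => _) = (fun s => c s 0 i)) //.
  by apply/funext => s; rewrite pevX.
- rewrite dirdD (_ : (fun s => _) =
    (fun s => pev p (c s)) + (fun s => pev q (c s))); first exact: is_deriveD.
  by apply/funext => s; rewrite pevD.
- rewrite dirdM (_ : (fun s => _) =
    (fun s => pev p (c s)) * (fun s => pev q (c s))); last first.
    by apply/funext => s; rewrite pevM.
  apply: is_derive_eq; rewrite /GRing.scale /=; ring.
Qed.

Lemma continuous_pev p : continuous (pev p).
Proof.
move=> x; elim/mpoly_ring_ind: p => [a|i|p q dp dq|p q dp dq].
- rewrite (_ : pev _ = cst a); first exact: cst_continuous.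
  by apply/funext => s; rewrite /pev mevalC.
- rewrite (_ : pev _ = (fun s => s 0 i)); first exact: coord_continuous.
  by apply/funext => s; rewrite pevX.
- rewrite (_ : pev _ = (fun s => pev p s + pev q s)); first exact: continuousD.
  by apply/funext => s; rewrite pevD.
- rewrite (_ : pev _ = (fun s => pev p s * pev q s)); first exact: continuousM.
  by apply/funext => s; rewrite pevM.
Qed.

End PolynomialCalculus.

(** * Orthogonal transformations and the invariant integral *)

Section EuclideanGeometry.
Context {R : realType} {n : nat}.
Implicit Types (x y v w : 'rV[R]_n) (Q : 'M[R]_n).

Definition dotv x y : R := (x *m y^T) 0 0.

Lemma dotvE x y : dotv x y = \sum_i x 0 i * y 0 i.
Proof. by rewrite /dotv mxE; apply: eq_bigr => i _; rewrite mxE. Qed.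

Lemma dotvC x y : dotv x y = dotv y x.
Proof. by rewrite !dotvE; apply: eq_bigr => i _; rewrite mulrC. Qed.

Lemma dotvDl x y w : dotv (x + y) w = dotv x w + dotv y w.
Proof. by rewrite /dotv mulmxDl mxE. Qed.

Lemma dotvZl c x w : dotv (c *: x) w = c * dotv x w.
Proof. by rewrite /dotv -scalemxAl mxE. Qed.

Lemma dotvBl x y w : dotv (x - y) w = dotv x w - dotv y w.
Proof. by rewrite dotvDl -scaleN1r dotvZl mulN1r. Qed.

Lemma dotvBr x y w : dotv w (x - y) = dotv w x - dotv w y.
Proof. by rewrite dotvC dotvBl !(dotvC w). Qed.

Lemma dotv_ge0 x : 0 <= dotv x x.
Proof. by rewrite dotvE sumr_ge0 // => i _; rewrite -expr2 sqr_ge0. Qed.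

Lemma dotv_eq0 x : dotv x x = 0 -> x = 0.
Proof.
rewrite dotvE => /eqP; rewrite psumr_eq0 => [/allP h|i _]; last first.
  by rewrite -expr2 sqr_ge0.
apply/rowP => i; have := h i (mem_index_enum i).
by rewrite mulf_eq0 orbb mxE => /eqP.
Qed.

Lemma enorm_sqr x : enorm x ^+ 2 = dotv x x.
Proof.
rewrite /enorm sqr_sqrtr ?dotvE; first by apply: eq_bigr.
by rewrite sumr_ge0 // => i _; rewrite sqr_ge0.
Qed.

Lemma enorm_ge0 x : 0 <= enorm x.
Proof. exact: sqrtr_ge0. Qed.

Lemma coord_le_enorm x i : `|x 0 i| <= enorm x.
Proof.
rewrite -[leRHS]ger0_norm ?enorm_ge0 // -ler_sqr ?nnegrE //.
rewrite !real_normK ?num_real // enorm_sqr dotvE (bigD1 i) //= -expr2 lerDl.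
by rewrite sumr_ge0 // => j _; rewrite -expr2 sqr_ge0.
Qed.

Lemma dotv_orth Q x y : Q *m Q^T = 1%:M -> dotv (x *m Q) (y *m Q) = dotv x y.
Proof. by move=> hQ; rewrite /dotv trmx_mul mulmxA -(mulmxA x) hQ mulmx1. Qed.

(* For [w = 0] this is the identity, since [2 / 0 = 0]. *)
Definition reflmx w : 'M[R]_n := 1%:M - (2 / dotv w w) *: (w^T *m w).

Lemma mul_reflmx w x : x *m reflmx w = x - (2 * dotv x w / dotv w w) *: w.
Proof.
rewrite /reflmx mulmxBr mulmx1 -scalemxAr mulmxA [x *m w^T]mx11_scalar.
rewrite mul_scalar_mx scalerA -/(dotv x w); congr (_ - _ *: _); ring.
Qed.

Lemma reflmx_orth w : reflmx w *m (reflmx w)^T = 1%:M.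
Proof.
have -> : (reflmx w)^T = reflmx w.
  by rewrite /reflmx linearB /= linearZ /= trmx_mul trmxK trmx1.
apply/row_matrixP => i; rewrite row_mul row1 [row i (reflmx w)]rowE.
set x := delta_mx 0 i; rewrite [x *m _]mul_reflmx mul_reflmx.
have [->|w0] := eqVneq w 0; first by rewrite !scaler0 !subr0.
have ww : dotv w w != 0 by apply: contra_neq w0; exact: dotv_eq0.
rewrite dotvBl dotvZl -addrA -opprD -scalerDl.
rewrite [X in X *: w](_ : _ = 0) ?scale0r ?subr0 //.
by field.
Qed.

Lemma reflmx_fix w x : dotv x w = 0 -> x *m reflmx w = x.
Proof. by move=> xw; rewrite mul_reflmx xw mulr0 mul0r scale0r subr0. Qed.

(** For vectors of equal length the hyperplane orthogonal to [x - y] is their mirror. *)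
Lemma reflmx_map x y : dotv x x = dotv y y -> x *m reflmx (x - y) = y.
Proof.
move=> xy; rewrite mul_reflmx.
have [/eqP|w0] := eqVneq (x - y) 0.
  by rewrite subr_eq0 => /eqP ->; rewrite subrr scaler0 subr0.
have ww : dotv (x - y) (x - y) != 0 by apply: contra_neq w0; exact: dotv_eq0.
have e : dotv (x - y) (x - y) = 2 * dotv x (x - y).
  by rewrite dotvBl !dotvBr (dotvC y x) -xy; ring.
by rewrite e divff -?e // scale1r subKr.
Qed.

Lemma orth_transitive x y : dotv x x = dotv y y ->
  exists2 Q, Q *m Q^T = 1%:M & x *m Q = y.
Proof.
by move=> xy; exists (reflmx (x - y)); [exact: reflmx_orth|exact: reflmx_map].
Qed.

(** After [x] has been moved to [y], the reflection that carries the image of [v] to [w] fixes [y],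
    because both of these vectors are orthogonal to [y]. *)
Lemma orth_transitive2 x v y w :
  dotv x x = dotv y y -> dotv v v = dotv w w -> dotv x v = 0 -> dotv y w = 0 ->
  exists Q, [/\ Q *m Q^T = 1%:M, x *m Q = y & v *m Q = w].
Proof.
move=> xy vw xv yw; have [Q hQ xQ] := orth_transitive xy.
have vQ : dotv y (v *m Q) = 0 by rewrite -xQ dotv_orth.
exists (Q *m reflmx (v *m Q - w)); split.
- by rewrite trmx_mul mulmxA -(mulmxA Q) reflmx_orth mulmx1.
- by rewrite mulmxA xQ reflmx_fix // dotvBr vQ yw subrr.
- by rewrite mulmxA reflmx_map // dotv_orth.
Qed.

End EuclideanGeometry.

Section SphereIntegral.
Context {R : realType} {d : nat} (sigma : probability (borel_rV R d) R).
Notation S := (sphere R d).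
Local Notation n := d.+1.

Lemma sphereP (x : 'rV[R]_n) : S x <-> dotv x x = 1.
Proof.
rewrite -enorm_sqr; split => [/= ->|/eqP]; first by rewrite expr1n.
by rewrite sqrp_eq1 ?enorm_ge0 // => /eqP.
Qed.

Lemma closed_sphere : closed S.
Proof.
pose p : mpoly n R := \sum_i mpolyX R (mnm1 i) * mpolyX R (mnm1 i).
have -> : S = pev p @^-1` [set 1].
  apply/seteqP; split => x; rewrite sphereP /= => <-;
  by rewrite dotvE pev_sum; apply: eq_bigr => i _; rewrite pevM pevX.
by apply: preimage_closed => [x _|]; [exact: continuous_pev|exact: closed_eq].
Qed.

Lemma compact_sphere : compact S.
Proof.
apply: bounded_closed_compact closed_sphere.
exists 1; split => // M M1 x Sx; apply: ltW; apply: le_lt_trans M1.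
rewrite [leLHS]mx_normrE; apply/bigmax_leP; split => // -[i j] _ /=.
by rewrite ord1 (le_trans (coord_le_enorm x j)) // Sx.
Qed.

Lemma measurable_open (U : set 'rV[R]_n) : open U ->
  measurable (U : set (borel_rV R d)).
Proof. exact: sub_sigma_algebra. Qed.

Lemma measurable_closed (U : set 'rV[R]_n) : closed U ->
  measurable (U : set (borel_rV R d)).
Proof.
move=> cU; rewrite -(setCK U); apply: measurableC; apply: measurable_open.
exact: closed_openC.
Qed.

Lemma measurable_sphere : measurable (S : set (borel_rV R d)).
Proof. by apply: measurable_closed; exact: closed_sphere. Qed.

Lemma continuous_measurable_real (f : 'rV[R]_n -> R) : continuous f ->
  measurable_fun setT (f : borel_rV R d -> R).
Proof.
move=> /continuousP cf; apply: (measurability _ (RGenOpens.measurableE R)).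
move=> _ [_ [a [b ->] <-]]; rewrite setTI; apply: measurable_open.
by apply: cf; exact: interval_open.
Qed.

Lemma continuous_integrable (f : 'rV[R]_n -> R) : continuous f ->
  sigma.-integrable (S : set (borel_rV R d))
    (EFin \o (f : borel_rV R d -> R)).
Proof.
move=> cf; apply: measurable_bounded_integrable.
- exact: measurable_sphere.
- by rewrite (le_lt_trans (probability_le1 _ _)) ?ltry //; exact: measurable_sphere.
- by apply: measurable_funTS; exact: continuous_measurable_real.
have /compact_bounded [M [Mr hM]] : compact (f @` S).
  apply: continuous_compact compact_sphere.
  by apply: continuous_subspaceT => x; exact: cf.
exists M; split => // y My x Sx; apply: hM => //; by exists x.
Qed.

Definition sint (f : 'rV[R]_n -> R) : R :=
  (\int[sigma]_(x in (S : set (borel_rV R d))) f x)%R.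

Lemma sintD (f g : 'rV[R]_n -> R) : continuous f -> continuous g ->
  sint (fun x => f x + g x) = sint f + sint g.
Proof.
move=> cf cg; rewrite /sint RintegralD //; first exact: measurable_sphere.
- exact: continuous_integrable.
- exact: continuous_integrable.
Qed.

Lemma sintZ c (f : 'rV[R]_n -> R) : continuous f -> sint (fun x => c * f x) = c * sint f.
Proof.
move=> cf; rewrite /sint RintegralZl //; first exact: measurable_sphere.
exact: continuous_integrable.
Qed.

Lemma eq_sint f g : (forall x, S x -> f x = g x) -> sint f = sint g.
Proof. by move=> fg; apply: eq_Rintegral => x; rewrite inE => /fg. Qed.

Hypothesis hsigma : is_uniform_sphere sigma.

Lemma sint_cst c : sint (fun=> c) = c.
Proof.
rewrite /sint Rintegral_cst; last exact: measurable_sphere.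
rewrite (_ : fine _ = 1) ?mulr1 //; exact: (congr1 fine hsigma.1).
Qed.

Lemma continuous_mulmx (Q : 'M[R]_n) : continuous (fun x : 'rV[R]_n => x *m Q).
Proof.
rewrite (_ : (fun x => _) = (fun x : 'rV[R]_n => \sum_i x 0 i *: row i Q)).
  apply: (continuous_big add_continuous) => i _ x.
  apply: continuousZr_tmp; exact: coord_continuous.
by apply/funext => x; rewrite mulmx_sum_row.
Qed.

Lemma sint_orth (Q : 'M[R]_n) (f : 'rV[R]_n -> R) : Q *m Q^T = 1%:M -> continuous f ->
  sint (fun x => f (x *m Q)) = sint f.
Proof.
move=> hQ cf; pose phi : borel_rV R d -> borel_rV R d := fun x => x *m Q.
have mphi : measurable_fun setT phi.
  apply: (@measurability _ _ (borel_rV R d) (borel_rV R d) setT phi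
    (@open 'rV[R]_n)) => // _ [U oU <-].
  rewrite setTI; apply: measurable_open.
  by move/continuousP : (continuous_mulmx (Q := Q)); apply.
rewrite /sint /Rintegral; congr fine.
have preS : phi @^-1` S = S.
  by apply/seteqP; split => x /=; rewrite /phi !sphereP dotv_orth.
have mf : measurable_fun setT (fun x : borel_rV R d => (f x)%:E).
  by apply/measurable_EFinP; exact: continuous_measurable_real.
have cfQ : continuous (fun x : 'rV[R]_n => f (x *m Q)).
  by move=> x; apply: (continuous_comp (@continuous_mulmx Q x)); exact: cf.
rewrite -[in LHS]preS -(@integral_pushforward _ _ (borel_rV R d) (borel_rV R d) R phi
  mphi sigma S _ mf).
- by apply: eq_measure_integral => A mA _; rewrite /pushforward; exact: hsigma.2.
- by rewrite preS; exact: (continuous_integrable cfQ).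
- exact: measurable_sphere.
Qed.

(** The measure has full support: if the open set where [f] exceeds half of [f x0] were null,
    finitely many of its rotated copies, all of them null, would cover the compact sphere, which has
    mass 1. *)
Lemma sint_gt0 (f : 'rV[R]_n -> R) x0 : continuous f -> (forall x, 0 <= f x) -> S x0 ->
  0 < f x0 -> 0 < sint f.
Proof.
move=> cf f0 Sx0 fx0; pose e := f x0 / 2; pose U := [set x | e < f x].
have e0 : 0 < e by rewrite divr_gt0.
have oU : open U.
  apply: (@open_comp _ _ f [set y | e < y]) => [x _|]; [exact: cf|exact: open_gt].
pose V (Q : 'M[R]_n) := (fun x : 'rV[R]_n => x *m Q) @^-1` U.
have oV Q : open (V Q) by apply: open_comp => // x _; exact: continuous_mulmx.
have mUS : measurable ((U `&` S) : set (borel_rV R d)).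
  by apply: measurableI; [exact: measurable_open|exact: measurable_sphere].
have sUS : (0 < sigma ((U `&` S) : set (borel_rV R d)))%E.
  rewrite lt0e measure_ge0 andbT; apply/eqP => sU0.
  have := compact_sphere; rewrite compact_cover.
  move=> /(_ _ [set Q | Q *m Q^T = 1%:M] V (fun Q _ => oV Q)) [].
    move=> x Sx; have [] := @orth_transitive _ _ x x0.
      by move/sphereP : Sx => ->; move/sphereP : Sx0 => ->.
    by move=> Q hQ xQ; exists Q => //=; rewrite /V /U /= xQ /e; lra.
  move=> D DQ cov; pose W (Q : 'M[R]_n) : set (borel_rV R d) :=
    [set x | (U `&` S) (x *m Q)].
  have DO (Q : 'M[R]_n) : Q \in D -> Q *m Q^T = 1%:M by move=> /DQ; rewrite inE.
  have SQ (Q : 'M[R]_n) : Q \in D -> forall x, S (x *m Q) <-> S x.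
    by move=> QD x; rewrite !sphereP dotv_orth //; exact: DO.
  have sW (Q : 'M[R]_n) : Q \in D -> measurable (W Q) /\ sigma (W Q) = 0%E.
    move=> QD; split; last by rewrite -sU0; apply: hsigma.2 => //; exact: DO.
    have -> : W Q = (V Q `&` S : set (borel_rV R d)).
      by apply/seteqP; split => x [Ux Sx]; split => //; apply/(SQ Q QD x).
    by apply: measurableI; [exact: measurable_open|exact: measurable_sphere].
  have : (sigma (S : set (borel_rV R d)) <= \sum_(Q \in [set` D]) sigma (W Q))%E.
    apply: content_sub_fsum => [//|Q /sW[]//||]; first exact: measurable_sphere.
    move=> x Sx; have [Q QD VQ] := cov x Sx; exists Q => //; split => //.
    exact/(SQ Q QD).
  rewrite fsbig1 => [|Q /sW[]//]; by rewrite hsigma.1 lee_fin ler10.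
have int := continuous_integrable cf.
have Ifin : (\int[sigma]_(x in (S : set (borel_rV R d))) (f x)%:E)%E
    \is a fin_num.
  by apply: integrable_fin_num => //; exact: measurable_sphere.
rewrite /sint /Rintegral fine_gt0 //; rewrite ltey_eq Ifin andbT.
have mf (A : set (borel_rV R d)) : measurable_fun A (fun x : borel_rV R d => (f x)%:E).
  by apply: measurable_funTS; apply/measurable_EFinP; exact: continuous_measurable_real.
apply: (@lt_le_trans _ _ (e%:E * sigma ((U `&` S) : set (borel_rV R d)))%E).
  by rewrite mule_gt0.
rewrite -(integral_cst _ mUS).
apply: (@le_trans _ _ (\int[sigma]_(x in ((U `&` S) : set (borel_rV R d))) (f x)%:E)%E).
  apply: ge0_le_integral => //.
  - by move=> x _; rewrite lee_fin ltW.
  - by move=> x [/ltW].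
apply: ge0_subset_integral => //; first exact: measurable_sphere.
by move=> x _; rewrite lee_fin.
Qed.

End SphereIntegral.

Lemma sum_delta (R : pzRingType) (I : finType) (i : I) (f : I -> R) :
  \sum_j f j * (j == i)%:R = f i.
Proof.
rewrite (bigD1 i) //= eqxx mulr1 big1 ?addr0 // => j ji.
by rewrite (negbTE ji) mulr0.
Qed.

Lemma is_derive_unique (R : realType) (f : R -> R) (t a b : R) :
  is_derive t 1 f a -> is_derive t 1 f b -> a = b.
Proof. by move=> /@derive_val <- /@derive_val. Qed.

(** * Orthonormal bases of forms and their reproducing kernel *)

Section OrthonormalHomogeneous.
Context {R : realType} {d : nat} (sigma : probability (borel_rV R d) R).
Hypothesis hsigma : is_uniform_sphere sigma.
Notation S := (sphere R d).
Local Notation n := d.+1.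
Implicit Types (p q : mpoly n R) (x y v : 'rV[R]_n).

Definition spoly p : R := sint sigma (pev p).

Lemma spolyD p q : spoly (p + q) = spoly p + spoly q.
Proof.
rewrite -sintD; try exact: continuous_pev.
by apply: eq_sint => x _; rewrite pevD.
Qed.

Lemma spolyZ c p : spoly (c *: p) = c * spoly p.
Proof.
rewrite -sintZ; last exact: continuous_pev.
by apply: eq_sint => x _; rewrite pevZ.
Qed.

Lemma spoly_sum (I : Type) (r : seq I) (P : pred I) (F : I -> mpoly n R) :
  spoly (\sum_(i <- r | P i) F i) = \sum_(i <- r | P i) spoly (F i).
Proof.
apply: (big_morph spoly spolyD).
by rewrite -[0](scale0r 1) spolyZ mul0r.
Qed.

Lemma eq_spoly p q : (forall x, S x -> pev p x = pev q x) -> spoly p = spoly q.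
Proof. exact: eq_sint. Qed.

Lemma spoly_const p c : (forall x, S x -> pev p x = c) -> spoly p = c.
Proof. by move=> pc; rewrite -[RHS](sint_cst hsigma); apply: eq_sint. Qed.

Lemma spoly_orth p q (Q : 'M[R]_n) : Q *m Q^T = 1%:M ->
  (forall x, pev q x = pev p (x *m Q)) -> spoly q = spoly p.
Proof.
move=> hQ e; rewrite /spoly -[RHS](sint_orth hsigma hQ (@continuous_pev _ _ p)).
by apply: eq_sint => x _.
Qed.

(** Invariance under the antipodal map -1 changes the sign of the integral. *)
Lemma spoly_odd p k : p \is ishomog1 k mdeg -> odd k -> spoly p = 0.
Proof.
move=> hp ok; have : spoly p = spoly (- p).
  apply: (@spoly_orth _ _ (- 1%:M)).
    by rewrite linearN /= trmx1 mulmxN mulNmx opprK mulmx1.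
  move=> x; rewrite mulmxN mulmx1.
  rewrite {1 2}(homog_span hp) -scaleN1r pevZ !pev_sum big_distrr /=.
  rewrite !big_seq; apply: eq_bigr => a; rewrite mem_mons => /eqP da.
  rewrite !pevZ /pev !mevalX mulrCA; congr (_ * _).
  under [in RHS]eq_bigr do rewrite mxE exprNn.
  rewrite big_split /= prodrXr -mdegE da -signr_odd ok expr1.
  by rewrite mulrA mulN1r opprK mul1r.
by rewrite -scaleN1r spolyZ mulN1r => ?; lra.
Qed.

Section Basis.
Variable k : nat.
Local Notation N := (size (mons n k)).

Definition hmon (i : 'I_N) : mpoly n R := mpolyX R (nth mnm0 (mons n k) i).

Lemma hmon_homog i : hmon i \is ishomog1 k mdeg.
Proof. by rewrite /hmon dhomogX /= -mem_mons mem_nth. Qed.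

Lemma hmon_span p : p \is ishomog1 k mdeg ->
  p = \sum_(i < N) mcoeff (nth mnm0 (mons n k) i) p *: hmon i.
Proof.
by move=> hp; rewrite {1}(homog_span hp) (big_nth mnm0) big_mkord.
Qed.

Lemma mcoeff_hmon (c : 'I_N -> R) (i : 'I_N) :
  mcoeff (nth mnm0 (mons n k) i) (\sum_j c j *: hmon j) = c i.
Proof.
rewrite raddf_sum /= -[RHS](sum_delta i c); apply: eq_bigr => j _.
by rewrite mcoeffZ mcoeffX nth_uniq ?uniq_mons.
Qed.

Lemma pev_homogZ p c x : p \is ishomog1 k mdeg ->
  pev p (c *: x) = c ^+ k * pev p x.
Proof.
move=> hp; rewrite (homog_span hp) !pev_sum big_distrr /= !big_seq.
apply: eq_bigr => a; rewrite mem_mons => /eqP da.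
rewrite !pevZ /pev !mevalX mulrCA; congr (_ * _).
under eq_bigr do rewrite mxE exprMn.
by rewrite big_split /= prodrXr -mdegE da.
Qed.

(** By homogeneity a value off the sphere is a multiple of a value on it. At the origin it is
    [0 ^+ k] times the value at any unit vector, which also settles degree 0. *)
Lemma homog_neq0 p : p \is ishomog1 k mdeg -> p != 0 ->
  exists2 x, S x & pev p x != 0.
Proof.
move=> hp p0; have [x px] : exists x, pev p x != 0.
  apply: contrapT => np; case/eqP: p0; apply: mpoly_fun_eq0 => x.
  apply/eqP/negPn/negP => px; apply: np; exists (\row_i x i).
  by rewrite /pev (meval_eq (v2 := x)) // => i; rewrite mxE.
have [x0|x0] := eqVneq x 0.
  exists (delta_mx 0 0).
    apply/sphereP; rewrite dotvE (bigD1 0) //= big1 ?addr0 => [|i i0].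
      by rewrite !mxE !eqxx mulr1.
    by rewrite !mxE (negbTE i0) andbF mulr0.
  apply: contra_neq px => py; rewrite x0 -(scale0r (delta_mx 0 0)).
  by rewrite pev_homogZ // py mulr0.
have xx : dotv x x != 0 by apply: contra_neq x0; exact: dotv_eq0.
have q0 : Num.sqrt (dotv x x) != 0.
  by rewrite gt_eqF // sqrtr_gt0 lt0r xx dotv_ge0.
exists ((Num.sqrt (dotv x x))^-1 *: x).
  apply/sphereP; rewrite dotvZl dotvC dotvZl mulrA -expr2 exprVn sqr_sqrtr.
    by rewrite mulVf.
  exact: dotv_ge0.
by rewrite pev_homogZ // mulf_neq0 // expf_neq0 // invr_neq0.
Qed.

Definition hbasis (G : 'M[R]_N) (a : 'I_N) : mpoly n R :=
  \sum_i G a i *: hmon i.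

Lemma hbasis_homog G a : hbasis G a \is ishomog1 k mdeg.
Proof. by apply: rpred_sum => i _; apply: rpredZ; exact: hmon_homog. Qed.

(** The Gram matrix of the monomials is positive definite: a nonzero form does not vanish
    identically on the sphere, so its square has a positive integral. *)
Lemma orthonormal_hbasis : exists2 G : 'M[R]_N, G \in unitmx &
  forall a b, spoly (hbasis G a * hbasis G b) = (a == b)%:R.
Proof.
pose M : 'M[R]_N := \matrix_(i, j) spoly (hmon i * hmon j).
have bil (A B : 'I_N -> R) :
    spoly ((\sum_i A i *: hmon i) * (\sum_j B j *: hmon j)) =
    \sum_i \sum_j A i * M i j * B j.
  rewrite big_distrl /= spoly_sum; apply: eq_bigr => i _.
  rewrite big_distrr /= spoly_sum; apply: eq_bigr => j _.
  rewrite mxE -!mul_mpolyC [X in spoly X](_ : _ =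
    (A i * B j) *: (hmon i * hmon j)) ?spolyZ; first by ring.
  by rewrite -!mul_mpolyC mpolyCM; ring.
have mxbil (u v : 'rV[R]_N) : (u *m M *m v^T) 0 0 =
    \sum_i \sum_j u 0 i * M i j * v 0 j.
  rewrite mxE exchange_big; apply: eq_bigr => j _.
  by rewrite !mxE big_distrl.
have [||G hG] := @posdef_orthonormalization R N M.
- by apply/matrixP => i j; rewrite !mxE mulrC.
- move=> u u0; rewrite mxbil -bil.
  set p := \sum_i _; have hp : p \is ishomog1 k mdeg.
    by apply: rpred_sum => i _; apply: rpredZ; exact: hmon_homog.
  have p0 : p != 0.
    apply: contra_neq u0 => p0; apply/rowP => i.
    by rewrite -(mcoeff_hmon (fun i => u 0 i)) -/p p0 mcoeff0 mxE.
  have [x Sx px] := homog_neq0 hp p0.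
  apply: (sint_gt0 hsigma (x0 := x)) => //; first exact: continuous_pev.
    by move=> y; rewrite pevM -expr2 sqr_ge0.
  by rewrite pevM -expr2 lt0r sqrf_eq0 px sqr_ge0.
exists G; first by have [] := mulmx1_unit (etrans (mulmxA _ _ _) hG).
move=> a b; rewrite bil.
transitivity ((row a G *m M *m (row b G)^T) 0 0).
  by rewrite mxbil; apply: eq_bigr => i _; apply: eq_bigr => j _; rewrite !mxE.
transitivity ((G *m M *m G^T) a b); last by rewrite hG mxE.
rewrite -row_mul mxE [RHS]mxE; apply: eq_bigr => j _.
by rewrite !mxE.
Qed.

Section Kernel.
Variable G : 'M[R]_N.
Hypothesis Gunit : G \in unitmx.
Hypothesis Gorth :
  forall a b, spoly (hbasis G a * hbasis G b) = (a == b)%:R.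
Local Notation F := (hbasis G).

Lemma spoly_lin a (c : 'I_N -> R) : spoly ((\sum_b c b *: F b) * F a) = c a.
Proof.
rewrite big_distrl /= spoly_sum -[RHS](sum_delta a c); apply: eq_bigr => b _.
by rewrite -scalerAl spolyZ Gorth.
Qed.

Lemma spoly_bilin (A B : 'I_N -> R) :
  spoly ((\sum_a A a *: F a) * (\sum_b B b *: F b)) = \sum_a A a * B a.
Proof.
rewrite [in X in _ * X](eq_bigr (fun b => B b *: F b)) // big_distrr /=.
rewrite spoly_sum; apply: eq_bigr => b _.
by rewrite -scalerAr spolyZ spoly_lin mulrC.
Qed.

Lemma hmon_hbasis i : hmon i = \sum_a (invmx G) i a *: F a.
Proof.
rewrite /hbasis; under eq_bigr do rewrite scaler_sumr.
rewrite exchange_big /= -[LHS]scale1r.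
transitivity (\sum_j (invmx G *m G) i j *: hmon j).
  rewrite mulVmx // (bigD1 i) //= mxE eqxx big1 ?addr0 // => j ji.
  by rewrite mxE eq_sym (negbTE ji) scale0r.
apply: eq_bigr => j _; rewrite mxE scaler_suml; apply: eq_bigr => a _.
by rewrite scalerA.
Qed.

Lemma hbasis_span p : p \is ishomog1 k mdeg ->
  exists c : 'I_N -> R, p = \sum_a c a *: F a.
Proof.
move=> hp; rewrite (hmon_span hp).
exists (fun a => \sum_(i < N) mcoeff (nth mnm0 (mons n k) i) p * invmx G i a).
under eq_bigr do rewrite hmon_hbasis scaler_sumr.
rewrite exchange_big; apply: eq_bigr => a _ /=.
by rewrite scaler_suml; apply: eq_bigr => i _; rewrite scalerA.
Qed.

(** A linear substitution preserves forms of degree [k], and the invariance of the integral makes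
    its matrix in an orthonormal basis orthogonal. *)
Lemma hbasis_rot (Q : 'M[R]_n) : Q *m Q^T = 1%:M ->
  exists2 U : 'M[R]_N, U^T *m U = 1%:M &
    forall a x, pev (F a) (x *m Q) = \sum_b U a b * pev (F b) x.
Proof.
move=> hQ.
have /choice [c hc] a : exists c : 'I_N -> R,
    forall x, pev (F a) (x *m Q) = \sum_b c b * pev (F b) x.
  have [q hq e] := homog_linear_subst Q (hbasis_homog G a).
  have [c qc] := hbasis_span hq; exists c => x.
  have -> : pev (F a) (x *m Q) = pev q x.
    by rewrite /pev -e; apply: meval_eq => i; rewrite mxE.
  by rewrite qc pev_sum; apply: eq_bigr => b _; rewrite pevZ.
exists (\matrix_(a, b) c a b); last first.
  by move=> a x; rewrite hc; apply: eq_bigr => b _; rewrite mxE.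
apply: mulmx1C; apply/matrixP => a b; rewrite !mxE -Gorth.
rewrite -(@spoly_orth _ ((\sum_e c a e *: F e) * (\sum_e c b e *: F e)) Q) //.
  by rewrite spoly_bilin; apply: eq_bigr => e _; rewrite !mxE.
move=> x; rewrite !pevM !hc !pev_sum.
by congr (_ * _); apply: eq_bigr => e _; rewrite pevZ.
Qed.

Lemma sum_orth (U : 'M[R]_N) (f g : 'I_N -> R) : U^T *m U = 1%:M ->
  \sum_a (\sum_b U a b * f b) * (\sum_b U a b * g b) = \sum_a f a * g a.
Proof.
move=> hU; transitivity (\sum_b \sum_e (U^T *m U) b e * (f b * g e)).
  under eq_bigr do rewrite big_distrl /=.
  rewrite exchange_big; apply: eq_bigr => b _ /=.
  under eq_bigr do rewrite big_distrr /=.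
  rewrite exchange_big; apply: eq_bigr => e _ /=.
  rewrite mxE big_distrl; apply: eq_bigr => a _ /=; rewrite mxE; ring.
apply: eq_bigr => b _; rewrite hU (bigD1 b) //= mxE eqxx mul1r big1 ?addr0 //.
by move=> e eb; rewrite mxE eq_sym (negbTE eb) mul0r.
Qed.

Lemma kernel_orth (Q : 'M[R]_n) x y : Q *m Q^T = 1%:M ->
  \sum_a pev (F a) (x *m Q) * pev (F a) (y *m Q) =
  \sum_a pev (F a) x * pev (F a) y.
Proof.
move=> hQ; have [U hU e] := hbasis_rot hQ.
by under eq_bigr do rewrite !e; exact: sum_orth.
Qed.

(** The left hand side is rotation invariant, hence constant on the sphere, and its integral counts
    the basis. *)
Lemma kernel_diag x : S x -> \sum_a pev (F a) x ^+ 2 = N%:R.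
Proof.
move=> Sx; have <- : spoly (\sum_a F a * F a) = N%:R.
  rewrite spoly_sum; under eq_bigr do rewrite Gorth eqxx.
  by rewrite sumr_const card_ord.
apply/esym/spoly_const => y Sy; rewrite pev_sum.
have [Q hQ <-] : exists2 Q, Q *m Q^T = 1%:M & x *m Q = y.
  by apply: orth_transitive; move/sphereP: Sx => ->; move/sphereP: Sy => ->.
under eq_bigr do rewrite pevM.
by rewrite kernel_orth //; apply: eq_bigr.
Qed.

Lemma dird_orth (Q : 'M[R]_n) x v : Q *m Q^T = 1%:M ->
  \sum_a dird (F a) (x *m Q) (v *m Q) ^+ 2 = \sum_a dird (F a) x v ^+ 2.
Proof.
move=> hQ; have [U hU e] := hbasis_rot hQ.
(* The identity [e] is differentiated along the line [x + t *: v]. *)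
have e' a : dird (F a) (x *m Q) (v *m Q) = \sum_b U a b * dird (F b) x v.
  pose c (t : R) : 'rV[R]_n := x + t *: v.
  have dc i : is_derive (0 : R) 1 (fun s => c s 0 i) (v 0 i).
    rewrite (_ : (fun s => _) = (fun s : R => x 0 i + s * v 0 i)).
      by apply: is_derive_eq; rewrite /GRing.scale /=; ring.
    by apply/funext => s; rewrite !mxE.
  have dcQ i : is_derive (0 : R) 1 (fun s => (c s *m Q) 0 i) ((v *m Q) 0 i).
    rewrite (_ : (fun s => _) =
        (fun s : R => (x *m Q) 0 i + s * (v *m Q) 0 i)).
      by apply: is_derive_eq; rewrite /GRing.scale /=; ring.
    by apply/funext => s; rewrite /c mulmxDl -scalemxAl !mxE.
  have c0 : c 0 = x by rewrite /c scale0r addr0.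
  have dlm := @is_derive_pev _ _ (F a) (fun s => c s *m Q) 0 _ dcQ.
  have drm := @is_derive_pev _ _ (\sum_b U a b *: F b) c 0 _ dc.
  rewrite c0 in dlm drm; transitivity (dird (\sum_b U a b *: F b) x v).
    have ee : (fun s => pev (F a) (c s *m Q)) =
        (fun s => pev (\sum_b U a b *: F b) (c s)).
      apply/funext => s; rewrite e pev_sum.
      by apply: eq_bigr => b _; rewrite pevZ.
    by rewrite ee in dlm; exact: is_derive_unique dlm drm.
  by rewrite dird_sum; apply: eq_bigr => b _; rewrite dirdZ.
under eq_bigr do rewrite e' expr2.
by rewrite sum_orth //; apply: eq_bigr.
Qed.

End Kernel.
End Basis.
End OrthonormalHomogeneous.

(** * Plane rotations and the tangential energy of a basis *)

Section PlaneRotations.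
Context {R : realType} {n : nat}.
Variables i j : 'I_n.
Hypothesis ij : i != j.
Implicit Types x : 'rV[R]_n.

Lemma dotv_delta x l : dotv x (delta_mx 0 l) = x 0 l.
Proof.
rewrite dotvE -[RHS](sum_delta l (fun k => x 0 k)); apply: eq_bigr => k _.
by rewrite mxE eqxx.
Qed.

(** The velocity field of the rotation whose action on polynomials is [rotgen]; see
    [dird_rotvec]. *)
Definition rotvec x : 'rV[R]_n := x 0 i *: delta_mx 0 j - x 0 j *: delta_mx 0 i.

Lemma rotvecE x k :
  rotvec x 0 k = x 0 i * (k == j)%:R - x 0 j * (k == i)%:R.
Proof. by rewrite !mxE !eqxx. Qed.

Lemma dotv_rotvec x y :
  dotv y (rotvec x) = x 0 i * y 0 j - x 0 j * y 0 i.
Proof.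
by rewrite dotvC dotvBl !dotvZl ![dotv (delta_mx _ _) _]dotvC !dotv_delta.
Qed.

Lemma dotv_rotvec_rotvec x :
  dotv (rotvec x) (rotvec x) = x 0 i * x 0 i + x 0 j * x 0 j.
Proof.
rewrite dotv_rotvec !rotvecE !eqxx (negbTE ij) eq_sym (negbTE ij) /=; ring.
Qed.

Lemma dird_rotvec p x : dird p x (rotvec x) = pev (rotgen i j p) x.
Proof.
have e q r : pev (q - r) x = pev q x - pev r x.
  by rewrite pevD -scaleN1r pevZ mulN1r.
rewrite /rotgen e !pevM !pevX /dird.
under eq_bigr do rewrite rotvecE mulrBl -mulrA -[X in _ - X]mulrA.
rewrite big_split /= sumrN -!big_distrr /=.
congr (_ * _ - _ * _).
- rewrite -[RHS](sum_delta j (fun k => pev (mderiv k p) x)).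
  by apply: eq_bigr => k _; rewrite mulrC.
- rewrite -[RHS](sum_delta i (fun k => pev (mderiv k p) x)).
  by apply: eq_bigr => k _; rewrite mulrC.
Qed.

(* A product of two reflections, i.e. the rotation by the angle [2 t] in the
   plane of the [i]-th and [j]-th coordinates. *)
Definition rotmx (t : R) : 'M[R]_n :=
  reflmx (delta_mx 0 i) *m
  reflmx (cos t *: delta_mx 0 i + sin t *: delta_mx 0 j).

Lemma rotmx_orth t : rotmx t *m (rotmx t)^T = 1%:M.
Proof.
by rewrite trmx_mul mulmxA -(mulmxA (reflmx _)) reflmx_orth mulmx1 reflmx_orth.
Qed.

Lemma mul_rotmx x t l : (x *m rotmx t) 0 l =
  x 0 l - 2 * x 0 i * (l == i)%:R -
  2 * (x 0 j * sin t - x 0 i * cos t) *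
    (cos t * (l == i)%:R + sin t * (l == j)%:R).
Proof.
have ii : dotv (delta_mx 0 i) (delta_mx 0 i) = 1 :> R.
  by rewrite dotv_delta mxE !eqxx.
have jj : dotv (delta_mx 0 j) (delta_mx 0 j) = 1 :> R.
  by rewrite dotv_delta mxE !eqxx.
have ji : dotv (delta_mx 0 j) (delta_mx 0 i) = 0 :> R.
  by rewrite dotv_delta mxE (negbTE ij) andbF.
have ij' : dotv (delta_mx 0 i) (delta_mx 0 j) = 0 :> R by rewrite dotvC.
rewrite mulmxA [x *m _]mul_reflmx mul_reflmx ii divr1 dotv_delta.
set w := cos t *: _ + _; have ww : dotv w w = 1.
  rewrite {1}/w dotvDl !dotvZl ![dotv (delta_mx _ _) w]dotvC /w !dotvDl !dotvZl ii jj.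
  by rewrite ji ij' -[RHS](cos2Dsin2 t); ring.
rewrite ww divr1 dotvC dotvBr {1}/w dotvDl !dotvZl ![dotv (delta_mx _ _) _]dotvC.
rewrite !dotv_delta dotvC dotvZl [dotv _ w]dotvC /w dotvDl !dotvZl ii ji.
by rewrite !mxE !eqxx /=; ring.
Qed.

Lemma rotmx0 x : x *m rotmx 0 = x.
Proof.
apply/rowP => l; rewrite mul_rotmx sin0 cos0; ring.
Qed.

Lemma is_derive_rotmx x l :
  is_derive (0 : R) 1 (fun t => (x *m rotmx t) 0 l) ((2 *: rotvec x) 0 l).
Proof.
rewrite (_ : (fun t => _) = (fun t : R => x 0 l - 2 * x 0 i * (l == i)%:R -
  2 * (x 0 j * sin t - x 0 i * cos t) *
    (cos t * (l == i)%:R + sin t * (l == j)%:R))); last first.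
  by apply/funext => t; exact: mul_rotmx.
apply: is_derive_eq; rewrite mxE rotvecE sin0 cos0 /GRing.scale /=; ring.
Qed.

End PlaneRotations.

Section Energy.
Context {R : realType} {d : nat} (sigma : probability (borel_rV R d) R).
Hypothesis hsigma : is_uniform_sphere sigma.
Notation S := (sphere R d).
Local Notation n := d.+1.
Variables i j : 'I_n.
Hypothesis ij : i != j.
Implicit Types (p q : mpoly n R) (x y v : 'rV[R]_n).

(** All coordinates have the same mean square by symmetry, and the squares add up to 1. *)
Lemma spoly_coord_sqr (l : 'I_n) :
  spoly sigma (mpolyX R (mnm1 l) * mpolyX R (mnm1 l)) = n%:R^-1.
Proof.
pose q l := mpolyX R (mnm1 l) * mpolyX R (mnm1 l) : mpoly n R.
have e m : spoly sigma (q m) = spoly sigma (q l).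
  have [Q hQ eQ] : exists2 Q : 'M[R]_n, Q *m Q^T = 1%:M &
      delta_mx 0 m *m Q = delta_mx 0 l :> 'rV[R]_n.
    by apply: orth_transitive; rewrite !dotv_delta !mxE !eqxx.
  apply: (spoly_orth hsigma hQ) => x; rewrite /q !pevM !pevX.
  by rewrite -!(dotv_delta (x *m Q)) -eQ dotv_orth // dotv_delta.
have : spoly sigma (\sum_m q m) = 1.
  apply: (spoly_const hsigma) => x /sphereP <-; rewrite dotvE pev_sum.
  by apply: eq_bigr => m _; rewrite pevM pevX.
rewrite spoly_sum (eq_bigr (fun=> spoly sigma (q l))) => [|m _]; last exact: e.
rewrite sumr_const card_ord => h.
have n0 : n%:R != 0 :> R by rewrite pnatr_eq0.
by apply: (mulfI n0); rewrite mulr_natl h mulfV.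
Qed.

Variable k : nat.
Local Notation N := (size (mons n k)).
Variable G : 'M[R]_N.
Hypothesis Gunit : G \in unitmx.
Hypothesis Gorth :
  forall a b, spoly sigma (hbasis G a * hbasis G b) = (a == b)%:R.
Local Notation F := (hbasis G).

Let Lam : 'M[R]_N :=
  \matrix_(a, b) mcoeff (nth mnm0 (mons n k) b) (rotgen i j (hmon a)).

Let rotgen_hmon (a : 'I_N) : rotgen i j (hmon a) = \sum_b Lam a b *: hmon b.
Proof.
rewrite {1}[rotgen _ _ _](@hmon_span _ _ k); last first.
  have dk : mdeg (nth mnm0 (mons n k) a) = k.
    by apply/eqP; rewrite -mem_mons mem_nth.
  by have := @homog_rotgenX R n i j (nth mnm0 (mons n k) a); rewrite dk.
by apply: eq_bigr => b _; rewrite mxE.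
Qed.

Let tr_Lam2 : \tr (Lam *m Lam) = - (2 * 'C(k + n, n.+1))%:R.
Proof.
rewrite /mxtrace.
under eq_bigr => a _.
  have -> : (Lam *m Lam) a a =
      mcoeff (nth mnm0 (mons n k) a) (rotgen i j (rotgen i j (hmon a))).
    rewrite rotgen_hmon rotgen_sum raddf_sum mxE; apply: eq_bigr => b _ /=.
    by rewrite rotgenZ mcoeffZ [Lam b a]mxE.
  rewrite mcoeff_rotgen2 //; over.
rewrite sumrN -natr_sum; congr (- _%:R).
rewrite -(big_mkord xpredT (fun a => let m := nth mnm0 (mons n k) a in
  m i * (m j).+1 + m j * (m i).+1)%N).
rewrite -(big_nth mnm0 xpredT (fun m => m i * (m j).+1 + m j * (m i).+1)%N).
have ji : j != i by rewrite eq_sym.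
by rewrite big_split /= !sum_mons_coord2 // mul2n addnn.
Qed.

(** The operator of [Lam] in the orthonormal basis. The conjugation keeps the trace of the square,
    computed for [Lam], and gains skew-symmetry. *)
Let Sm : 'M[R]_N := G *m Lam *m invmx G.

Let rotgen_hbasis a : rotgen i j (F a) = \sum_b Sm a b *: F b.
Proof.
rewrite {1}/hbasis rotgen_sum.
transitivity (\sum_c (G *m Lam) a c *: hmon c).
  under eq_bigr do rewrite rotgenZ rotgen_hmon scaler_sumr.
  rewrite exchange_big; apply: eq_bigr => c _ /=.
  by rewrite mxE scaler_suml; apply: eq_bigr => b _; rewrite scalerA.
under eq_bigr do rewrite (hmon_hbasis Gunit) scaler_sumr.
rewrite exchange_big; apply: eq_bigr => c _ /=.
by rewrite mxE scaler_suml; apply: eq_bigr => b _; rewrite scalerA.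
Qed.

Let tr_Sm2 : \tr (Sm *m Sm) = - (2 * 'C(k + n, n.+1))%:R.
Proof.
rewrite -tr_Lam2 /Sm -!mulmxA (mulmxA (invmx G)) mulVmx // mul1mx.
by rewrite mxtrace_mulC -!mulmxA mulVmx // mulmx1.
Qed.

(** The derivative at angle 0 of the rotation invariance of the reproducing kernel. *)
Let kernel_skew x y :
  \sum_a (pev (rotgen i j (F a)) x * pev (F a) y +
          pev (F a) x * pev (rotgen i j (F a)) y) = 0.
Proof.
have dF a z : is_derive (0 : R) 1 (fun t => pev (F a) (z *m rotmx i j t))
    (2 * pev (rotgen i j (F a)) z).
  have := @is_derive_pev _ _ (F a) (fun t => z *m rotmx i j t) 0 _
    (is_derive_rotmx ij z).
  by rewrite rotmx0 // dird_scale dird_rotvec.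
have dK : is_derive (0 : R) 1 (\sum_a (fun t => pev (F a) (x *m rotmx i j t)) *
    (fun t => pev (F a) (y *m rotmx i j t)))
  (\sum_a (pev (F a) x *: (2 * pev (rotgen i j (F a)) y) +
           pev (F a) y *: (2 * pev (rotgen i j (F a)) x))).
  apply: is_derive_sum => a.
  by apply: is_derive_eq; rewrite !(rotmx0 ij).
have dK0 : is_derive (0 : R) 1 (\sum_a (fun t => pev (F a) (x *m rotmx i j t)) *
    (fun t => pev (F a) (y *m rotmx i j t))) 0.
  rewrite (_ : \sum_a _ = cst (\sum_a pev (F a) x * pev (F a) y)).
    exact: is_derive_cst.
  apply/funext => t; rewrite fct_sumE /=.
  rewrite -[RHS](kernel_orth hsigma Gunit Gorth _ _ (rotmx_orth i j t)).
  by apply: eq_bigr.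
have := is_derive_unique dK dK0; rewrite /GRing.scale /= => h.
apply: (@mulfI _ 2) => //; rewrite mulr0 -[RHS]h big_distrr /=.
by apply: eq_bigr => a _; ring.
Qed.

(** Expand [kernel_skew] in the products of a basis form in [x] with one in [y], and compare
    coefficients in one variable at a time. *)
Let Sm_skew : Sm^T = - Sm.
Proof.
have pS a x : pev (rotgen i j (F a)) x = \sum_b Sm a b * pev (F b) x.
  by rewrite rotgen_hbasis pev_sum; apply: eq_bigr => b _; rewrite pevZ.
have kS x y : \sum_b (\sum_a (Sm a b + Sm b a) * pev (F a) y) * pev (F b) x = 0.
  rewrite -[RHS](kernel_skew x y) big_split /=.
  have -> : \sum_a pev (rotgen i j (F a)) x * pev (F a) y =
      \sum_b (\sum_a Sm a b * pev (F a) y) * pev (F b) x.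
    under eq_bigr do rewrite pS big_distrl /=.
    rewrite exchange_big; apply: eq_bigr => b _ /=.
    by rewrite big_distrl; apply: eq_bigr => a _ /=; ring.
  rewrite -big_split; apply: eq_bigr => b _ /=.
  rewrite pS [X in _ = _ + X]mulrC -mulrDl -big_split /=; congr (_ * _).
  by apply: eq_bigr => a _; ring.
have lin0 (c : 'I_N -> R) : (forall x, \sum_b c b * pev (F b) x = 0) ->
    forall b, c b = 0.
  move=> c0 b; rewrite -(spoly_lin Gorth b c).
  apply: (spoly_const hsigma) => x _; rewrite pevM pev_sum.
  by under eq_bigr do rewrite pevZ; rewrite c0 mul0r.
apply/matrixP => a b; rewrite mxE [RHS]mxE; apply/eqP; rewrite -addr_eq0; apply/eqP.
apply: (lin0 (fun b => Sm b a + Sm a b)) => y.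
exact: (lin0 (fun a => \sum_b (Sm b a + Sm a b) * pev (F b) y) (fun x => kS x y) a).
Qed.

Let energy x v : R := \sum_a dird (F a) x v ^+ 2.

Let energy_tangent x v : S x -> dotv x v = 0 ->
  energy x v = energy (delta_mx 0 i) (delta_mx 0 j) * dotv v v.
Proof.
move=> Sx xv; have energyZ c w z : energy z (c *: w) = c ^+ 2 * energy z w.
  rewrite /energy big_distrr; apply: eq_bigr => a _ /=.
  by rewrite dird_scale exprMn.
have [->|v0] := eqVneq v 0.
  rewrite -(scale0r 0) energyZ dotvZl expr0n /=; ring.
have vv : dotv v v != 0 by apply: contra_neq v0; exact: dotv_eq0.
have sq : Num.sqrt (dotv v v) ^+ 2 = dotv v v by rewrite sqr_sqrtr ?dotv_ge0.
have q0 : Num.sqrt (dotv v v) != 0 by rewrite -sqrf_eq0 sq.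
pose u := (Num.sqrt (dotv v v))^-1 *: v.
have uu : dotv u u = 1.
  by rewrite dotvZl dotvC dotvZl mulrA -expr2 exprVn sq mulVf.
have xu : dotv x u = 0 by rewrite dotvC dotvZl dotvC xv mulr0.
have -> : v = Num.sqrt (dotv v v) *: u by rewrite scalerA mulfV // scale1r.
rewrite energyZ dotvZl dotvC dotvZl uu mulr1 -expr2 mulrC; congr (_ * _).
have [|||| Q [hQ <- <-]] := @orth_transitive2 _ _ (delta_mx 0 i) (delta_mx 0 j) x u.
- by rewrite dotv_delta mxE !eqxx; apply/esym/sphereP.
- by rewrite uu dotv_delta mxE !eqxx.
- by rewrite dotv_delta mxE eq_sym (negbTE ij) andbF.
- exact: xu.
exact: (dird_orth hsigma Gunit Gorth).
Qed.

(* By transitivity on orthonormal 2-frames the left hand side is a constant times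
   [dotv v v].  For [v = rotvec x] the integral of the left hand side is the squared
   norm of the skew matrix of the infinitesimal rotation, i.e. minus the trace of
   its square, which can be computed on monomials. *)
Lemma kernel_energy x v : S x -> dotv x v = 0 ->
  \sum_a dird (F a) x v ^+ 2 = (n * 'C(k + n, n.+1))%:R * dotv v v.
Proof.
move=> Sx xv; rewrite -/(energy x v) energy_tangent //; congr (_ * _).
set E := energy _ _.
have : spoly sigma (\sum_a rotgen i j (F a) * rotgen i j (F a)) =
    (2 * 'C(k + n, n.+1))%:R.
  rewrite spoly_sum; under eq_bigr do rewrite rotgen_hbasis (spoly_bilin Gorth).
  transitivity (\tr (Sm *m Sm^T)).
    rewrite /mxtrace; apply: eq_bigr => a _; rewrite [RHS]mxE.
    by apply: eq_bigr => b _; rewrite [Sm^T b a]mxE.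
  by rewrite Sm_skew mulmxN linearN /= tr_Sm2 opprK.
(* The squared length of the rotation field is the sum of the squares of two coordinates, whose mean
   is [2 / n]; this is where the factor [n] of the constant comes from. *)
rewrite (@eq_spoly _ _ _ _ (E *: (mpolyX R (mnm1 i) * mpolyX R (mnm1 i) +
  mpolyX R (mnm1 j) * mpolyX R (mnm1 j)))); last first.
  move=> y Sy; rewrite pev_sum pevZ pevD !pevM !pevX -dotv_rotvec_rotvec //.
  rewrite -(energy_tangent Sy); last by rewrite dotv_rotvec mulrC subrr.
  by apply: eq_bigr => a _; rewrite pevM dird_rotvec expr2.
rewrite spolyZ spolyD !spoly_coord_sqr => h.
have n0 : n%:R != 0 :> R by rewrite pnatr_eq0.
have : E * 2 = n%:R * (2 * 'C(k + n, n.+1))%:R by rewrite -h; field.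
by rewrite !natrM mulrCA mulrC => h2; apply: (@mulfI _ 2).
Qed.

End Energy.

(** * Lipschitz curves and arclength *)

Section MonotoneLipschitz.
Context {R : realType}.
Notation mu := (@lebesgue_measure R).
Variable F : R -> R.
Hypothesis Fnd : {homo F : x y / x <= y}.
Hypothesis Flip : forall x y, x <= y -> F y - F x <= y - x.

Let H x := x - F x.

Let Hnd : {homo H : x y / x <= y}.
Proof. by move=> x y xy; have := Flip xy; rewrite /H; lra. Qed.

Let Fcont : continuous F.
Proof.
move=> x; apply/cvgrPdist_le => e e0; near=> y.
have : `|x - y| <= e.
  near: y; apply: cvgr_dist_le => //; exact: cvg_id.
apply: le_trans; have [xy|yx] := leP x y.
  rewrite ler0_norm ?subr_le0 ?Fnd // ler0_norm ?subr_le0 //.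
  by have := Flip xy; lra.
rewrite ger0_norm ?subr_ge0 ?Fnd ?(ltW yx) // ger0_norm ?subr_ge0 ?(ltW yx) //.
exact: Flip (ltW yx).
Unshelve. all: by end_near. Qed.

Let Frc : right_continuous F.
Proof. exact: right_continuousW Fcont. Qed.

Let Hrc : right_continuous H.
Proof.
apply: right_continuousW => x; apply: continuousB; first exact: cvg_id.
exact: Fcont.
Qed.

Let cF : cumulative R R := HB.pack F (isCumulative.Build R _ R F Fnd Frc).
Let cH : cumulative R R := HB.pack H (isCumulative.Build R _ R H Hnd Hrc).
Let mF := lebesgue_stieltjes_measure cF.
Let mH := lebesgue_stieltjes_measure cH.

Let stieltjes_itv (f : cumulative R R) (a b : R) : a <= b ->
  lebesgue_stieltjes_measure f `]a, b]%classic = (f b - f a)%:E.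
Proof.
move=> ab; rewrite /lebesgue_stieltjes_measure /measure_extension.
rewrite measurable_mu_extE /=; last exact: is_ocitv.
by rewrite wlength_itv_bnd.
Qed.

(** The Stieltjes measures of [F] and of [H = id - F], both nondecreasing, add up to Lebesgue
    measure. *)
Let mF_le A : measurable A -> (mF A <= mu A)%E.
Proof.
move=> mA; rewrite (@lebesgue_measure_unique R (measure_add mF mH)) //.
  by rewrite [leRHS]measure_addE leeDl.
move=> X /ocitvP[->|[[a b] /= ab ->]]; first by rewrite !measure0.
rewrite [LHS](stieltjes_itv idfun) ?ltW // [RHS]measure_addE /mF /mH.
transitivity ((F b - F a)%:E + (H b - H a)%:E)%E; last first.
  rewrite -(stieltjes_itv cF (ltW ab)) -(stieltjes_itv cH (ltW ab)) //.
rewrite -EFinD /H /=; congr EFin; ring.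
Qed.

(** Domination by Lebesgue measure gives a Radon-Nikodym density, and Lebesgue differentiation
    identifies it with the derivative almost everywhere. The measure is restricted to []a, b]] to be
    finite, which makes the density integrable on the whole line. *)
Lemma monotone_lipschitz_density (a b : R) : a < b -> exists h : R -> R,
  [/\ mu.-integrable [set: R] (EFin \o h),
      forall c e, a <= c -> c <= e -> e <= b ->
        F e - F c = (\int[mu]_(x in `]c, e]) h x)%R &
      {ae mu, forall x, x \in `]a, b[ -> is_derive x 1 F (h x)}].
Proof.
move=> ab; have fin : (mF `]a, b]%classic < +oo)%E.
  by rewrite /mF stieltjes_itv ?ltW // ltry.
have mI : measurable (`]a, b]%classic : set (measurableTypeR R)).
  exact: measurable_itv.
pose nu : {finite_measure set (measurableTypeR R) -> \bar R} :=
  @mfrestr _ _ R _ mF mI fin.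
have numu : nu `<< mu.
  apply/null_content_dominatesP => A mA A0; apply/eqP.
  rewrite -measure_le0 -A0; apply: le_trans (mF_le mA).
  rewrite /nu /= /mfrestr /mrestr; apply: le_measure; rewrite ?inE //.
  exact: measurableI.
pose g := Radon_Nikodym_SigmaFinite.f nu mu.
have gfin x : g x \is a fin_num by exact: Radon_Nikodym_SigmaFinite.f_fin_num.
have gE : EFin \o (fine \o g) = g by apply/funext => x /=; rewrite fineK.
have gint : mu.-integrable [set: R] (EFin \o (fine \o g)).
  by rewrite gE; exact: Radon_Nikodym_SigmaFinite.f_integrable.
have Fint c e : a <= c -> c <= e -> e <= b ->
    F e - F c = (\int[mu]_(x in `]c, e]) (fine \o g) x)%R.
  move=> ac ce eb; rewrite /Rintegral.
  have -> : (\int[mu]_(x in `]c, e]) ((fine \o g) x)%:E = nu `]c, e]%classic)%E.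
    rewrite (Radon_Nikodym_SigmaFinite.f_integral numu); last exact: measurable_itv.
    by apply: eq_integral => x _; rewrite -[RHS](congr1 (fun f => f x) gE).
  rewrite /nu /= /mfrestr /mrestr setIidl; first by rewrite /mF stieltjes_itv.
  by apply: subset_itv; rewrite bnd_simp.
exists (fine \o g); split => //.
have loc : locally_integrable [set: R] (fine \o g).
  by apply: open_integrable_locally => //; exact: openT.
have := @FTC1 R (fine \o g) (BRight a) _ loc.
have gi y : mu.-integrable `]a, y] (EFin \o (fine \o g)).
  by apply: integrableS gint => //; exact: measurable_itv.
move=> /(_ gi).
apply: filterS; first exact: (ae_filter_ringOfSetsType mu).
move=> x /= dx xab; have := xab; rewrite in_itv => /andP[ax xb].
have [dG eG] := dx ax.
pose I (y : R) : R := (\int[mu]_(t in `]a, y]) (fine \o g) t)%R.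
have dGx : is_derive x 1 (cst (F a) + I) ((fine \o g) x).
  have dI : is_derive x 1 I (I^`()%classic x).
    by rewrite derive1E; apply: derivableP; exact: dG.
  by apply: is_derive_eq; rewrite add0r; exact: eG.
apply: near_eq_is_derive dGx; near=> y.
have : y \in `]a, b[ by near: y; exact: near_in_itvoo.
rewrite in_itv => /andP[ay yb].
by rewrite fctE /I -Fint ?lexx ?(ltW ay) ?(ltW yb) //= addrC subrK.
Unshelve. all: by end_near. Qed.

End MonotoneLipschitz.

Section Clamp.
Context {R : realFieldType} (a b : R).
Hypothesis ab : a <= b.

Definition clamp (x : R) := Num.max a (Num.min b x).

Lemma clamp_in x : clamp x \in `[a, b].
Proof.
rewrite in_itv /= /clamp le_max lexx /= ge_max ab /=.
by rewrite ge_min lexx.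
Qed.

Lemma clamp_id x : x \in `[a, b] -> clamp x = x.
Proof.
rewrite in_itv /= => /andP[ax xb].
by rewrite /clamp min_r // max_r.
Qed.

Lemma clamp_mono x y : x <= y -> 0 <= clamp y - clamp x <= y - x.
Proof.
move=> xy; have ab' := ab; rewrite /clamp.
case: (leP b x) => bx; case: (leP b y) => byy; rewrite ?(max_r ab); try lra.
- by case: (leP a x) => ax; lra.
- by case: (leP a x) => ax; case: (leP a y) => ay; lra.
Qed.

Lemma clamp_lip x y : `|clamp x - clamp y| <= `|x - y|.
Proof.
wlog xy : x y / x <= y.
  by move=> h; case: (leP x y) => xy; [|rewrite distrC [leRHS]distrC];
    apply: h => //; exact: ltW.
have /andP[h0 h1] := clamp_mono xy.
by rewrite distrC ger0_norm // distrC ger0_norm // subr_ge0.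
Qed.

End Clamp.

Section LipschitzFTC.
Context {R : realType}.
Notation mu := (@lebesgue_measure R).

(* Any [K]-Lipschitz [f] is [2 K F - K id] for a nondecreasing 1-Lipschitz [F],
   after extending [f] by constants outside of [[a, b]]. *)
Lemma lipschitz_density (f : R -> R) (a b K : R) : a < b ->
  (forall x y, x \in `[a, b] -> y \in `[a, b] -> `|f x - f y| <= K * `|x - y|) ->
  exists g : R -> R,
  [/\ mu.-integrable `[a, b] (EFin \o g),
      forall c e, a <= c -> c <= e -> e <= b ->
        f e - f c = (\int[mu]_(x in `]c, e]) g x)%R &
      {ae mu, forall x, x \in `]a, b[ -> is_derive x 1 f (g x)}].
Proof.
(* The maximum with 1 makes the divisor [2 * L] of [F] positive whatever the sign of [K]. *)
move=> ab flip; pose L := Num.max K 1.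
have L0 : 0 < L by rewrite lt_max ltr01 orbT.
pose cl := clamp a b; have clab := clamp_in (ltW ab).
have clE x : x \in `[a, b] -> cl x = x by exact: clamp_id.
have cl_nd := clamp_mono (ltW ab).
pose F x := (f (cl x) + L * cl x) / (2 * L).
have flipL x y : x <= y -> `|f (cl y) - f (cl x)| <= L * (cl y - cl x).
  move=> xy; have /andP[c0 _] := cl_nd _ _ xy.
  rewrite (le_trans (flip _ _ _ _)) // ger0_norm // ler_wpM2r //.
  by rewrite le_max lexx.
have L2 : 0 < 2 * L by rewrite mulr_gt0.
have Fnd : {homo F : x y / x <= y}.
  move=> x y xy; rewrite /F ler_pM2r ?invr_gt0 //.
  by have := flipL _ _ xy; rewrite ler_norml => /andP[]; lra.
have Flip x y : x <= y -> F y - F x <= y - x.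
  move=> xy; rewrite /F -mulrBl ler_pdivrMr //.
  have /andP[c0 c1] := cl_nd _ _ xy.
  have := flipL _ _ xy; rewrite ler_norml => /andP[_ h].
  have : L * (cl y - cl x) <= L * (y - x) by rewrite ler_wpM2l // ltW.
  by lra.
have fE x : x \in `[a, b] -> f x = 2 * L * F x - L * x.
  by move=> xab; rewrite /F clE //; field; rewrite gt_eqF.
have [h [hint hF dF]] := monotone_lipschitz_density Fnd Flip ab.
have hintD (D : set (measurableTypeR R)) : measurable D -> mu.-integrable D (EFin \o h).
  by move=> mD; apply: integrableS hint.
have cint (i : interval R) (r : R) : (mu [set` i] < +oo)%E ->
    mu.-integrable [set` i] (EFin \o cst r).
  have mi : measurable ([set` i] : set (measurableTypeR R)).
    exact: measurable_itv.
  by move=> ifin; apply: (measurable_bounded_integrable mi) => //; exact: bounded_cst.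
have fin (b1 b2 : bool) (c e : R) :
    (mu [set` Interval (BSide b1 c) (BSide b2 e)] < +oo)%E.
  by rewrite /= lebesgue_measure_itv /=; case: ifP => _; rewrite ltry.
exists (fun x => 2 * L * h x - L); split.
- rewrite (_ : EFin \o _ = (fun x => (2 * L)%:E * (EFin \o h) x - (EFin \o cst L) x)%E) //.
  apply: integrableB; [exact: measurable_itv| |apply: cint; exact: fin].
  by apply: integrableZl; [exact: measurable_itv|apply: hintD; exact: measurable_itv].
- move=> c e ac ce eb; rewrite !fE ?in_itv /= ?ac ?eb ?(le_trans ac ce) ?(le_trans ce eb) //.
  rewrite RintegralB; [|exact: measurable_itv| |apply: cint; exact: fin]; last first.
    rewrite (_ : EFin \o _ = (fun x => (2 * L)%:E * (EFin \o h) x)%E) //.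
    by apply: integrableZl; [exact: measurable_itv|apply: hintD; exact: measurable_itv].
  rewrite RintegralZl; [|exact: measurable_itv|by apply: hintD; exact: measurable_itv].
  rewrite -hF // Rintegral_cst; last exact: measurable_itv.
  have -> : fine (mu `]c, e]%classic) = e - c.
    rewrite /= lebesgue_measure_itv /= lte_fin; case: ltP => //= ec.
    by apply/eqP; rewrite eq_sym subr_eq0 eq_le ec ce.
  ring.
move: dF; apply: filterS; first exact: (ae_filter_ringOfSetsType mu).
move=> x dx xab; have {}dx := dx xab.
have dG : is_derive x 1 (fun y => 2 * L * F y - L * y) (2 * L * h x - L).
  by apply: is_derive_eq; rewrite /GRing.scale /=; ring.
apply: near_eq_is_derive dG; near=> y; apply/esym/fE.
have : y \in `]a, b[ by near: y; exact: near_in_itvoo.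
by rewrite !in_itv /= => /andP[/ltW -> /ltW ->].
Unshelve. all: by end_near. Qed.

End LipschitzFTC.

(** * Integrals of functions that agree almost everywhere *)

Section AlmostEverywhereIntegral.
Context d (T : measurableType d) (R : realType) (mu : {measure set T -> \bar R}).
Local Open Scope ereal_scope.
Import HBNNSimple.

Let sintegral_null (N : set T) (h : {nnsfun T >-> R}) (mN : measurable N) :
  mu N = 0 -> sintegral mu h = sintegral mu (proj_nnsfun h (measurableC mN)).
Proof.
move=> N0; rewrite -mrestrict -integral_nnsfun; last exact: measurableC.
have -> : sintegral mu h = \int[mu]_(x in setT) (h x)%:E.
  by rewrite integral_nnsfun // patch_setT.
rewrite (@ge0_negligible_integral _ _ _ mu setT N) ?setTD //.
- by apply/measurable_EFinP; exact: measurable_funP.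
- by move=> x _; rewrite lee_fin; exact: fun_ge0.
Qed.

Let ge0_ae_le_integral (D : set T) (f g : T -> \bar R) :
  (forall x, D x -> 0 <= f x) -> (forall x, D x -> 0 <= g x) ->
  {ae mu, forall x, D x -> f x = g x} ->
  \int[mu]_(x in D) f x <= \int[mu]_(x in D) g x.
Proof.
move=> f0 g0 [N [mN N0 fgN]]; rewrite !ge0_integralE //.
apply/ge_ereal_sup => /= _ [h hf <-]; rewrite (sintegral_null h mN) //.
apply: ereal_sup_ubound; exists (proj_nnsfun h (measurableC mN)) => // x.
have /= -> : proj_nnsfun h (measurableC mN) x = (h \_ (~` N)) x.
  by rewrite (mrestrict h (measurableC mN)).
rewrite /patch; case: ifPn => xN.
  apply: le_trans (hf x) _; rewrite /patch; case: ifPn => // xD.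
  rewrite (_ : f x = g x) //; apply: contrapT => fg.
  move: xN; rewrite inE; apply; apply: fgN => /= e; apply: fg; apply: e.
  by rewrite inE in xD.
by rewrite /patch; case: ifPn => // xD; apply: g0; rewrite inE in xD.
Qed.

(* Neither function need be measurable: the integral of a nonnegative function
   is a supremum over simple functions, which can be cut off on a null set. *)
Lemma ae_integral (D : set T) (f g : T -> \bar R) :
  {ae mu, forall x, D x -> f x = g x} ->
  \int[mu]_(x in D) f x = \int[mu]_(x in D) g x.
Proof.
have ge0_eq (u v : T -> \bar R) : (forall x, 0 <= u x) -> (forall x, 0 <= v x) ->
    {ae mu, forall x, D x -> u x = v x} ->
    \int[mu]_(x in D) u x = \int[mu]_(x in D) v x.
  move=> u0 v0 uv; apply/eqP; rewrite eq_le; apply/andP; split.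
    exact: ge0_ae_le_integral.
  apply: ge0_ae_le_integral => //; move: uv; apply: filterS => x e Dx.
  by rewrite e.
move=> fg; rewrite [LHS]integralE [RHS]integralE.
by congr (_ - _); apply: ge0_eq => //; move: fg; apply: filterS => x e Dx;
  rewrite ?funeposE ?funenegE e.
Qed.

Lemma ae_Rintegral (D : set T) (f g : T -> R) :
  {ae mu, forall x, D x -> f x = g x} ->
  (\int[mu]_(x in D) f x)%R = (\int[mu]_(x in D) g x)%R.
Proof.
move=> fg; rewrite /Rintegral (ae_integral (g := fun x => (g x)%:E)) //.
by move: fg; apply: filterS => x e Dx; rewrite e.
Qed.

End AlmostEverywhereIntegral.

Section LipschitzCurve.
Context {R : realType} {d : nat}.
Notation mu := (@lebesgue_measure R).
Local Notation n := d.+1.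
Variable gamma : R -> 'rV[R]_n.
Let T : R := 2 * pi.

(** The curve on the closed interval [[0, T]], with the starting point as value at [T]: a Lipschitz
    function on a compact interval, to which [lipschitz_density] applies. *)
Definition closing (theta : R) : 'rV[R]_n :=
  if theta < T then gamma theta else gamma 0.

Hypothesis hgamma : closed_lipschitz_curve gamma.

Let T0 : 0 < T. Proof. by rewrite mulr_gt0 // pi_gt0. Qed.

Lemma closing_sphere theta : 0 <= theta -> sphere R d (closing theta).
Proof.
case: hgamma => hS _ _ _ t0; rewrite /closing; case: ltP => tT; apply: hS;
  by rewrite in_itv /= ?lexx ?T0 ?t0 ?tT.
Qed.

Lemma closing_lipschitz : exists2 K, 0 <= K & forall a b i,
  a \in `[0, T] -> b \in `[0, T] ->
  `|closing a 0 i - closing b 0 i| <= K * `|a - b|.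
Proof.
case: hgamma => hS [K0 hK] hlim _; pose K := Num.max K0 0.
exists K; first by rewrite le_max lexx orbT.
have K_ge0 : 0 <= K by rewrite le_max lexx orbT.
have lipT a b i : a \in `[0, T[ -> b \in `[0, T[ ->
    `|gamma a 0 i - gamma b 0 i| <= K * `|a - b|.
  move=> aT bT; have := coord_le_enorm (gamma a - gamma b) i; rewrite !mxE.
  move=> /le_trans; apply; apply: (le_trans (hK _ _ aT bT)).
  by rewrite ler_wpM2r // le_max lexx.
(* The estimate up to the endpoint [T] is the limit of those up to [t < T], since the curve tends to
   its starting point. *)
have lip0 a i : a \in `[0, T[ -> `|gamma a 0 i - gamma 0 0 i| <= K * `|a - T|.
  move=> aT; apply/ler_addgt0Pr => e e0.
  have limi : gamma theta 0 i @[theta --> T^'-] --> gamma 0 0 i.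
    exact: (cvg_comp _ _ hlim (@coord_continuous _ _ _ 0 i (gamma 0))).
  have [t [t1 t2 t3 t4]] : exists t, [/\ a <= t, 0 <= t, t < T &
      `|gamma 0 0 i - gamma t 0 i| <= e].
    have /andP[a0 aT'] : 0 <= a < T by move: aT; rewrite in_itv.
    near (T^'-) => t; exists t.
    have at_ : a < t by near: t; exact: nbhs_left_gt.
    split; [exact: ltW|exact: le_trans (ltW at_)|by near: t; exact: nbhs_left_lt|].
    by near: t; move/cvgrPdist_le : limi; apply.
  have tT : t \in `[0, T[ by rewrite in_itv /= t2.
  rewrite -(subrKA (gamma t 0 i)) (le_trans (ler_normD _ _)) //.
  rewrite lerD //; last by rewrite distrC.
  rewrite (le_trans (lipT _ _ _ aT tT)) // ler_wpM2l //.
  by rewrite !ler0_norm; lra.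
have split_itv a : a \in `[0, T] -> (a \in `[0, T[) \/ a = T.
  rewrite !in_itv /= => /andP[-> /=]; rewrite le_eqVlt => /orP[/eqP ->|]; first by right.
  by left.
move=> a b i /split_itv[aT|->] /split_itv[bT|->]; rewrite /closing ?ltxx.
- move: (aT) (bT); rewrite !in_itv /= => /andP[_ ->] /andP[_ ->]; exact: lipT.
- by move: (aT); rewrite in_itv /= => /andP[_ ->]; exact: lip0.
- move: (bT); rewrite in_itv /= => /andP[_ ->]; rewrite distrC [X in _ * X]distrC.
  exact: lip0.
- by rewrite !subrr normr0 mulr0.
Unshelve. all: by end_near. Qed.

Lemma closing_density : exists g : R -> 'rV[R]_n,
  (forall i, mu.-integrable `[0, T] (EFin \o (fun x => g x 0 i))) /\
  {ae mu, forall x, x \in `]0, T[ ->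
    forall i, is_derive x 1 (fun s => closing s 0 i) (g x 0 i)}.
Proof.
have [K K0 hK] := closing_lipschitz.
have /choice [g hg] i : exists g : R -> R,
    mu.-integrable `[0, T] (EFin \o g) /\
    {ae mu, forall x, x \in `]0, T[ -> is_derive x 1 (fun s => closing s 0 i) (g x)}.
  have [g [gi _ gd]] := lipschitz_density T0 (fun x y => hK x y i).
  by exists g.
exists (fun x => \row_i g i x); split=> [i|].
  rewrite (_ : _ \o _ = EFin \o g i); first exact: (hg i).1.
  by apply/funext => x /=; rewrite mxE.
have : \forall x \ae mu, forall i, x \in `]0, T[ ->
    is_derive x 1 (fun s => closing s 0 i) (g i x).
  apply: filter_forall => i; exact: (hg i).2.
apply: filterS; first exact: (ae_filter_ringOfSetsType mu).
by move=> x h xT i; rewrite mxE; exact: h.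
Qed.

End LipschitzCurve.

(** By Lagrange's identity. *)
Lemma sum_CauchySchwarz (R : realFieldType) (I : finType) (a b : I -> R) :
  (\sum_i a i * b i) ^+ 2 <= (\sum_i a i ^+ 2) * (\sum_i b i ^+ 2).
Proof.
have : 0 <= \sum_i \sum_j (a i * b j - a j * b i) ^+ 2.
  by apply: sumr_ge0 => i _; apply: sumr_ge0 => j _; exact: sqr_ge0.
have -> : \sum_i \sum_j (a i * b j - a j * b i) ^+ 2 =
    2 * ((\sum_i a i ^+ 2) * (\sum_i b i ^+ 2) - (\sum_i a i * b i) ^+ 2).
  have e (f g : I -> R) : (\sum_i f i) * (\sum_i g i) = \sum_i \sum_j f i * g j.
    by rewrite big_distrl /=; apply: eq_bigr => i _; rewrite big_distrr.
  rewrite mulrBr expr2 !e mulr_sumr mulr_sumr -sumrB.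
  under [RHS]eq_bigr do rewrite !mulr_sumr -sumrB.
  have sw : \sum_i \sum_j a i ^+ 2 * b j ^+ 2 = \sum_i \sum_j a j ^+ 2 * b i ^+ 2.
    by rewrite exchange_big.
  apply/eqP; rewrite -subr_eq0 -sumrB; apply/eqP.
  transitivity (\sum_i \sum_j (a j ^+ 2 * b i ^+ 2 - a i ^+ 2 * b j ^+ 2)).
    by apply: eq_bigr => i _; rewrite -sumrB; apply: eq_bigr => j _; ring.
  by under eq_bigr do rewrite sumrB; rewrite sumrB -sw subrr.
by lra.
Qed.

Lemma lipschitz_measurable (R : realType) (u : R -> R) (a b K : R) : a <= b ->
  (forall x y, x \in `[a, b] -> y \in `[a, b] -> `|u x - u y| <= K * `|x - y|) ->
  measurable_fun (`[a, b]%classic : set (measurableTypeR R)) u.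
Proof.
move=> ab ulip; pose cl := clamp a b; have clab := clamp_in ab.
pose L := Num.max K 1.
have L0 : 0 < L by rewrite lt_max ltr01 orbT.
have cl1 := clamp_lip ab.
have cu : continuous (u \o cl).
  move=> x; apply/cvgrPdist_le => e e0; near=> y.
  apply: (le_trans (ulip _ _ (clab _) (clab _))).
  apply: (@le_trans _ _ (L * `|x - y|)).
    apply: (@le_trans _ _ (L * `|cl x - cl y|)).
      by rewrite ler_wpM2r // le_max lexx.
    by rewrite ler_wpM2l // ltW.
  rewrite mulrC -ler_pdivlMr //; near: y.
  by apply: cvgr_dist_le; [exact: cvg_id|rewrite divr_gt0].
apply: (@eq_measurable_fun _ _ _ _ _ (u \o cl)).
  by move=> x; rewrite inE /= => xab; rewrite /cl clamp_id.
apply: measurable_funTS; exact: continuous_measurable_fun.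
Unshelve. all: by end_near. Qed.

Lemma enorm_le_sum (R : realType) (n : nat) (v : 'rV[R]_n) :
  enorm v <= \sum_i `|v 0 i|.
Proof.
have s0 : 0 <= \sum_i `|v 0 i| by apply: sumr_ge0.
rewrite -ler_sqr ?nnegrE ?enorm_ge0 // enorm_sqr dotvE expr2 big_distrl /=.
apply: ler_sum => i _; rewrite -expr2 -real_normK ?num_real // expr2.
by rewrite ler_wpM2l // (bigD1 i) //= lerDl sumr_ge0.
Qed.

Section Length.
Context {R : realType} {d : nat}.
Notation mu := (@lebesgue_measure R).
Local Notation n := d.+1.
Variable gamma : R -> 'rV[R]_n.
Hypothesis hgamma : closed_lipschitz_curve gamma.
Local Notation T := (2 * pi : R).
Local Notation c := (closing gamma).

Let T0 : 0 < T. Proof. by rewrite mulr_gt0 // pi_gt0. Qed.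

Variable g : R -> 'rV[R]_n.
Hypothesis gint : forall i, mu.-integrable `[0, T] (EFin \o (fun x => g x 0 i)).
Hypothesis gder : {ae mu, forall x, x \in `]0, T[ ->
    forall i, is_derive x 1 (fun s => c s 0 i) (g x 0 i)}.

(** Built from the almost everywhere derivative [g], which is integrable by construction, in place
    of [speed gamma]; the total agrees with [curve_length] by [curve_length_arclen]. *)
Definition arclen (a b : R) : R := (\int[mu]_(x in `]a, b]) enorm (g x))%R.

Let mI (a b : R) : measurable (`]a, b]%classic : set (measurableTypeR R)).
Proof. exact: measurable_itv. Qed.

Let mIc (a b : R) : measurable (`[a, b]%classic : set (measurableTypeR R)).
Proof. exact: measurable_itv. Qed.

Lemma enorm_integrable : mu.-integrable `[0, T] (EFin \o (fun x => enorm (g x))).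
Proof.
have mg i : measurable_fun (`[0, T]%classic : set (measurableTypeR R)) (fun x => g x 0 i).
  by have /integrableP[/measurable_EFinP] := gint i.
have mw : measurable_fun (`[0, T]%classic : set (measurableTypeR R)) (fun x => enorm (g x)).
  apply: (@measurableT_comp _ _ _ _ _ _ (@Num.sqrt R)).
    by apply: continuous_measurable_fun; exact: sqrt_continuous.
  by apply: measurable_sum => i; exact: measurable_funX.
have gi : mu.-integrable `[0, T] (fun x => \sum_i (`|g x 0 i|)%:E)%E.
  apply: integrable_sum; first exact: mIc.
  by move=> i _; exact: (integrable_norm (gint i)).
apply: le_integrable gi; first exact: mIc.
  exact/measurable_EFinP.
move=> x _ /=; rewrite sumEFin lee_fin.
by rewrite !ger0_norm ?enorm_ge0 ?sumr_ge0 // enorm_le_sum.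
Qed.

Lemma arclen_ge0 a b : 0 <= arclen a b.
Proof. by apply: Rintegral_ge0 => x _; exact: enorm_ge0. Qed.

Lemma arclen_itv a b : 0 <= a -> b <= T ->
  mu.-integrable `]a, b] (EFin \o (fun x => enorm (g x))).
Proof.
move=> a0 bT; apply: integrableS enorm_integrable; [exact: mIc|exact: mI|].
by apply: subset_itv; rewrite bnd_simp.
Qed.

Lemma arclenD a b e : 0 <= a -> a <= b -> b <= e -> e <= T ->
  arclen a e = arclen a b + arclen b e.
Proof.
move=> a0 ab be eT; apply/eqP; rewrite addrC -subr_eq; apply/eqP.
apply: (@Rintegral_itvB _ _ (BRight a) (BRight e) b).
- exact: arclen_itv.
- by rewrite bnd_simp.
- by rewrite bnd_simp.
Qed.

(** A Lipschitz function is the integral of its derivative, so a derivative bound at the points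
    where the curve is differentiable is enough. *)
Lemma arclen_bound (u : R -> R) (K C : R) : 0 <= C ->
  (forall x y, x \in `[0, T] -> y \in `[0, T] -> `|u x - u y| <= K * `|x - y|) ->
  (forall x, x \in `]0, T[ ->
    (forall i, is_derive x 1 (fun s => c s 0 i) (g x 0 i)) ->
    exists2 du, is_derive x 1 u du & `|du| <= C * enorm (g x)) ->
  forall a b, 0 <= a -> a <= b -> b <= T -> `|u b - u a| <= C * arclen a b.
Proof.
move=> C0 ulip uder a b a0 ab bT.
have [h [hi hE hd]] := lipschitz_density T0 ulip.
have hab : mu.-integrable `]a, b] (EFin \o h).
  apply: integrableS hi; [exact: mIc|exact: mI|].
  by apply: subset_itv; rewrite bnd_simp.
rewrite hE //; apply: le_trans (le_normr_Rintegral _ hab) _; first exact: mI.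
rewrite /arclen -RintegralZl; [|exact: mI|exact: arclen_itv].
have iC : mu.-integrable `]a, b] (EFin \o (fun x => C * enorm (g x))).
  have := @integrableZl _ _ _ mu _ (mI a b) C _ (arclen_itv a0 bT).
  by apply: eq_integrable => [|x _]; [exact: mI|].
rewrite /Rintegral fine_le //.
- by apply: integrable_fin_num; [exact: mI|exact: integrable_norm].
- by apply: integrable_fin_num; [exact: mI|exact: iC].
apply: ae_ge0_le_integral.
- exact: mI.
- by move=> x _; rewrite lee_fin.
- by have /integrableP[] := integrable_norm hab.
- by move=> x _; rewrite lee_fin mulr_ge0 // enorm_ge0.
- by have /integrableP[] := iC.
(* Derivatives are known on the open interval only, and [b] may be [T]. *)
have aeT : {ae mu, forall x : R, x != T}.
  exists [set T]; split => //; first exact: lebesgue_measure_set1.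
  by move=> x /= /negP; rewrite negbK => /eqP.
move: hd gder aeT; apply: filterS3; first exact: (ae_filter_ringOfSetsType mu).
move=> x hx gx xT; rewrite /= in_itv /= => /andP[ax xb].
have xI : x \in `]0, T[.
  by rewrite in_itv /= (le_lt_trans a0 ax) lt_neqAle xT (le_trans xb bT).
have [du ddu hdu] := uder x xI (gx xI).
by rewrite lee_fin (is_derive_unique (hx xI) ddu).
Qed.

Lemma closing_coord_arclen i a b : 0 <= a -> a <= b -> b <= T ->
  `|c b 0 i - c a 0 i| <= arclen a b.
Proof.
have [K K0 hK] := closing_lipschitz hgamma.
move=> a0 ab bT; rewrite -[leRHS]mul1r.
apply: (@arclen_bound (fun s => c s 0 i) K) => // [x y xT yT|x xT dx].
  exact: hK.
by exists (g x 0 i) => //; rewrite mul1r coord_le_enorm.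
Qed.

End Length.

Lemma pev_lipschitz_sphere (R : realType) (d : nat) (p : mpoly d.+1 R) :
  exists2 C, 0 <= C & forall x y, sphere R d x -> sphere R d y ->
    `|pev p x - pev p y| <= C * \sum_i `|x 0 i - y 0 i|.
Proof.
(* The bound on the values is carried along for the product case. *)
suff [C [C0 _ hC]] : exists C, [/\ 0 <= C,
    forall x, sphere R d x -> `|pev p x| <= C &
    forall x y, sphere R d x -> sphere R d y ->
      `|pev p x - pev p y| <= C * \sum_i `|x 0 i - y 0 i|] by exists C.
have s0 (x y : 'rV[R]_d.+1) : 0 <= \sum_i `|x 0 i - y 0 i| by exact: sumr_ge0.
elim/(@mpoly_ring_ind R d.+1): p => [a|i|p q [C [C0 bC lC]] [D [D0 bD lD]]|
    p q [C [C0 bC lC]] [D [D0 bD lD]]].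
- exists `|a|; split=> [//|x _|x y _ _]; rewrite /pev !mevalC // subrr normr0.
  by rewrite mulr_ge0.
- exists 1; split=> [//|x Sx|x y _ _]; rewrite !pevX.
    by rewrite (le_trans (coord_le_enorm x i)) // Sx.
  by rewrite mul1r (bigD1 i) //= lerDl sumr_ge0.
- exists (C + D); split=> [|x Sx|x y Sx Sy]; first exact: addr_ge0.
    by rewrite pevD (le_trans (ler_normD _ _)) // lerD ?bC ?bD.
  rewrite !pevD opprD addrACA (le_trans (ler_normD _ _)) // mulrDl.
  by rewrite lerD ?lC ?lD.
- exists (C * D + C * D); split=> [|x Sx|x y Sx Sy].
  + by rewrite addr_ge0 ?mulr_ge0.
  + rewrite pevM normrM (@le_trans _ _ (C * D)) ?ler_pM ?bC ?bD //.
    by rewrite lerDl mulr_ge0.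
  have -> : pev (p * q) x - pev (p * q) y =
      pev p x * (pev q x - pev q y) + (pev p x - pev p y) * pev q y.
    by rewrite !pevM; ring.
  rewrite (le_trans (ler_normD _ _)) // [leRHS]mulrDl !normrM lerD //.
    by rewrite -mulrA ler_pM ?bC ?lD.
  by rewrite mulrAC ler_pM ?lC ?bD.
Qed.

(** * Sampling the curve at equal distances of arclength *)

Section Sampling.
Context {R : realType} {d : nat}.
Notation mu := (@lebesgue_measure R).
Local Notation n := d.+1.
Variable gamma : R -> 'rV[R]_n.
Hypothesis hgamma : closed_lipschitz_curve gamma.
Local Notation T := (2 * pi : R).
Local Notation c := (closing gamma).

Let T0 : 0 < T. Proof. by rewrite mulr_gt0 // pi_gt0. Qed.

Variable g : R -> 'rV[R]_n.
Hypothesis gint : forall i, mu.-integrable `[0, T] (EFin \o (fun x => g x 0 i)).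
Hypothesis gder : {ae mu, forall x, x \in `]0, T[ ->
    forall i, is_derive x 1 (fun s => c s 0 i) (g x 0 i)}.
Local Notation arclen := (arclen g).

Let mI (a b : R) : measurable (`]a, b]%classic : set (measurableTypeR R)).
Proof. exact: measurable_itv. Qed.

Lemma speed_closing :
  {ae mu, forall x, x \in `]0, T[ -> speed gamma x = enorm (g x)}.
Proof.
move: gder; apply: filterS; first exact: (ae_filter_ringOfSetsType mu).
move=> x dx xT; have {}dx := dx xT.
have dgx i : is_derive x 1 (fun s => gamma s 0 i) (g x 0 i).
  apply: near_eq_is_derive (dx i); near=> y.
  have : y \in `]0, T[ by near: y; exact: near_in_itvoo.
  by rewrite in_itv /= /closing => /andP[_ ->].
have dg : derivable gamma x 1.
  by apply/derivable_mxP => i j; rewrite ord1; have [] := dgx j.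
rewrite /speed derive1E derive_mx //; congr enorm; apply/rowP => i.
by rewrite mxE; apply: derive_val.
Unshelve. all: by end_near. Qed.

Lemma integral_speed (f : 'rV[R]_n -> R) :
  mu.-integrable `]0, T] (EFin \o (fun x => f (c x) * enorm (g x))) ->
  (\int[mu]_(x in `[0, T[) (f (gamma x) * speed gamma x))%R =
  (\int[mu]_(x in `]0, T]) (f (c x) * enorm (g x)))%R.
Proof.
move=> fi; transitivity (\int[mu]_(x in `[0, T[) (f (c x) * enorm (g x)))%R.
  (* Measurability of the integrand with [speed gamma] has not been established, so the two
     integrals are compared by the version that does not ask for it. *)
  apply: ae_Rintegral.
  have ae0 : {ae mu, forall x : R, x != 0}.
    exists [set 0]; split => //; first exact: lebesgue_measure_set1.
    by move=> x /= /negP; rewrite negbK => /eqP.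
  move: speed_closing ae0; apply: filterS2; first exact: (ae_filter_ringOfSetsType mu).
  move=> x hx x0; rewrite /= in_itv /= => /andP[x0' xT].
  rewrite hx; last by rewrite in_itv /= lt_neqAle eq_sym x0 x0'.
  by rewrite /closing xT.
have fi' : mu.-integrable `]0, T[ (EFin \o (fun x => f (c x) * enorm (g x))).
  apply: integrableS fi; [exact: measurable_itv|exact: measurable_itv|].
  by apply: subset_itv; rewrite bnd_simp.
by rewrite -Rintegral_itv_obnd_cbnd // Rintegral_itv_bndo_bndc.
Qed.

Lemma curve_length_arclen : curve_length gamma = arclen 0 T.
Proof.
rewrite /curve_length /arclen.
transitivity (\int[mu]_(x in `[0, T[) (1 * speed gamma x))%R.
  by apply: eq_Rintegral => x _; rewrite mul1r.
rewrite (@integral_speed (fun=> 1)).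
  by apply: eq_Rintegral => x _; rewrite mul1r.
apply: eq_integrable (arclen_itv gint (lexx 0) (lexx T)) => [|x _]; first exact: mI.
by rewrite /= mul1r.
Qed.

Lemma pev_closing_lipschitz p : exists K, forall x y,
  x \in `[0, T] -> y \in `[0, T] ->
  `|pev p (c x) - pev p (c y)| <= K * `|x - y|.
Proof.
have [C C0 hC] := pev_lipschitz_sphere p.
have [K K0 hK] := closing_lipschitz hgamma.
exists (C * \sum_(i < n) K) => x y xT yT.
have S_ z : z \in `[0, T] -> sphere R d (c z).
  by rewrite in_itv => /andP[z0 _]; exact: closing_sphere.
rewrite (le_trans (hC _ _ (S_ _ xT) (S_ _ yT))) // -mulrA ler_wpM2l //.
by rewrite big_distrl ler_sum // => i _; exact: hK.
Qed.

Lemma pev_closing_arclen p : exists2 C, 0 <= C &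
  forall a b, 0 <= a -> a <= b -> b <= T ->
    `|pev p (c b) - pev p (c a)| <= C * arclen a b.
Proof.
have [C C0 hC] := pev_lipschitz_sphere p.
exists (C * n%:R) => [|a b a0 ab bT]; first by rewrite mulr_ge0.
rewrite (le_trans (hC _ _ _ _)) //; try apply: (closing_sphere hgamma) => //.
  exact: le_trans ab.
rewrite -mulrA ler_wpM2l // mulr_natl -[X in _ *+ X]card_ord -sumr_const.
by apply: ler_sum => i _; exact: closing_coord_arclen.
Qed.

(** A duality argument for the vector of features: its increment is tested against itself. The
    combination [P] with coefficients [D] increases by [Q], while by Cauchy-Schwarz its derivative
    is at most [C * enorm (g x)]; hence [Q] is at most [Num.sqrt (Q * B)] times the arclength, and
    one factor of [Q] cancels. *)
Lemma feature_arclen (I : finType) (F : I -> mpoly n R) (B : R) : 0 <= B ->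
  (forall x v, sphere R d x -> dotv x v = 0 ->
    \sum_a dird (F a) x v ^+ 2 <= B * dotv v v) ->
  forall a b, 0 <= a -> a <= b -> b <= T ->
    \sum_i (pev (F i) (c b) - pev (F i) (c a)) ^+ 2 <= B * arclen a b ^+ 2.
Proof.
move=> B0 hB a b a0 ab bT.
pose D i := pev (F i) (c b) - pev (F i) (c a).
rewrite -/(\sum_i D i ^+ 2); set Q := \sum_i _.
have Q0 : 0 <= Q by apply: sumr_ge0 => i _; exact: sqr_ge0.
pose P := \sum_i D i *: F i.
pose C := Num.sqrt (Q * B).
have C0 : 0 <= C := sqrtr_ge0 _.
have [K hK] := pev_closing_lipschitz P.
have : `|pev P (c b) - pev P (c a)| <= C * arclen a b.
  apply: (@arclen_bound _ _ _ g gint gder (fun s => pev P (c s)) K) => // x xT dx.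
  exists (dird P (c x) (g x)); first exact: is_derive_pev.
  have Sx : sphere R d (c x).
    by move: xT; rewrite in_itv /= => /andP[/ltW x0 _]; exact: closing_sphere.
  (* The velocity is tangent to the sphere because the squared norm is constant along the curve. *)
  have tang : dotv (c x) (g x) = 0.
    pose q : mpoly n R := \sum_i mpolyX R (mnm1 i) * mpolyX R (mnm1 i).
    have qE y : pev q y = dotv y y.
      by rewrite dotvE pev_sum; apply: eq_bigr => i _; rewrite pevM pevX.
    have d1 : is_derive x 1 (fun s => pev q (c s)) (dird q (c x) (g x)).
      exact: is_derive_pev.
    have d2 : is_derive x 1 (fun s => pev q (c s)) 0.
      apply: (@near_eq_is_derive R R R (cst 1)).
      near=> y; have : y \in `]0, T[ by near: y; exact: near_in_itvoo.
      rewrite in_itv /= => /andP[/ltW y0 _]; rewrite qE; apply/esym/sphereP.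
      exact: closing_sphere.
    have := is_derive_unique d1 d2; rewrite /q dird_sum.
    under eq_bigr do rewrite dirdM dirdX pevX.
    by rewrite big_split /= dotvE (eq_bigr (fun i => c x 0 i * g x 0 i)) => [|i _];
      [lra|rewrite mulrC].
  rewrite -ler_sqr ?nnegrE ?mulr_ge0 ?enorm_ge0 // real_normK ?num_real //.
  rewrite exprMn sqr_sqrtr ?mulr_ge0 // enorm_sqr -mulrA.
  rewrite /P dird_sum; under eq_bigr do rewrite dirdZ.
  rewrite (le_trans (sum_CauchySchwarz _ _)) // ler_wpM2l //.
  exact: hB.
have -> : pev P (c b) - pev P (c a) = Q.
  rewrite /P !pev_sum -sumrB; apply: eq_bigr => i _.
  by rewrite !pevZ -mulrBr -expr2.
rewrite ger0_norm // -ler_sqr ?nnegrE ?mulr_ge0 ?arclen_ge0 //.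
rewrite exprMn sqr_sqrtr ?mulr_ge0 // expr2 -mulrA.
have [->|Qn0] := eqVneq Q 0; first by rewrite mulr_ge0 // sqr_ge0.
by rewrite ler_pM2l // lt0r Qn0.
Unshelve. all: by end_near. Qed.

Local Notation L := (arclen 0 T).

Lemma arclen_nil a : arclen a a = 0.
Proof. by rewrite /arclen set_itvoc0 Rintegral_set0. Qed.

Lemma arclen_value (l : R) : 0 <= l <= L ->
  exists2 t, t \in `[0, T] & arclen 0 t = l.
Proof.
move=> l0.
have int := enorm_integrable gint.
have cont := parameterized_integral_continuous (ltW T0) int.
have e t : t <= T ->
    parameterized_integral mu 0 t (fun x => enorm (g x)) = arclen 0 t.
  move=> tT; rewrite /parameterized_integral -Rintegral_itv_obnd_cbnd //.
  exact: (arclen_itv gint (lexx 0)).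
have [|t tT] := IVT (ltW T0) cont (v := l).
  by rewrite !e ?(ltW T0) // arclen_nil min_l ?max_r ?arclen_ge0.
by move: (tT); rewrite in_itv => /andP[_ /e ->] <-; exists t.
Qed.

Lemma sample_points (M : nat) : (0 < M)%N -> exists theta : nat -> R,
  [/\ theta 0%N = 0, theta M = T,
      forall j, (j <= M)%N -> 0 <= theta j <= T,
      forall j, (j < M)%N -> theta j <= theta j.+1 &
      forall j, (j < M)%N -> arclen (theta j) (theta j.+1) = L / M%:R].
Proof.
move=> M0; have MR : 0 < M%:R :> R by rewrite ltr0n.
have L0 : 0 < L by rewrite -curve_length_arclen; case: hgamma.
(* The curve may stand still near the ends, so arclength alone does not force the first and last
   parameters to be 0 and [T]; they are prescribed. *)
have /choice [theta ht] (j : nat) : exists t : R, (j <= M)%N ->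
    [/\ 0 <= t <= T, arclen 0 t = j%:R * (L / M%:R), j = 0%N -> t = 0 &
        j = M -> t = T].
  have [jM|jM] := leqP j M; last by exists 0.
  have [j0|j0] := eqVneq j 0%N.
    exists 0 => _; rewrite j0 mul0r arclen_nil lexx ltW //; split => // M0'.
    by move: M0; rewrite -M0'.
  have [->|jM'] := eqVneq j M.
    exists T => _; split=> //; first by rewrite lexx ltW.
      by rewrite mulrCA mulfV ?gt_eqF // mulr1.
    by move=> M0'; move: M0; rewrite M0'.
  have [|t tT tE] := @arclen_value (j%:R * (L / M%:R)).
    rewrite mulr_ge0 ?divr_ge0 ?ler0n ?(ltW L0) //= mulrCA.
    by rewrite ler_piMr ?(ltW L0) // ler_pdivrMr // mul1r ler_nat.
  by exists t => _; split=> //; [move=> e; rewrite e eqxx in j0|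
    move=> e; rewrite e eqxx in jM'].
have mono j : (j < M)%N -> theta j <= theta j.+1.
  move=> jM; have [/andP[t0 tT] tE _ _] := ht j (ltnW jM).
  have [/andP[u0 uT] uE _ _] := ht j.+1 jM.
  rewrite leNgt; apply/negP => /ltW ut.
  have := arclenD gint (lexx 0) u0 ut tT; rewrite tE uE.
  have := arclen_ge0 g (theta j.+1) (theta j).
  have : 0 < L / M%:R by rewrite divr_gt0.
  by rewrite -natr1 mulrDl mul1r; lra.
exists theta; split => //.
- by have [_ _ h _] := ht 0%N (leq0n M); apply: h.
- by have [_ _ _ h] := ht M (leqnn M); apply: h.
- by move=> j jM; have [] := ht j jM.
- move=> j jM; have [/andP[t0 tT] tE _ _] := ht j (ltnW jM).
  have [/andP[u0 uT] uE _ _] := ht j.+1 jM.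
  have := arclenD gint (lexx 0) t0 (mono j jM) uT; rewrite tE uE.
  by rewrite -natr1 mulrDl mul1r; lra.
Qed.

Lemma pev_closing_integrable p a b : 0 <= a -> b <= T ->
  mu.-integrable `]a, b] (EFin \o (fun x => pev p (c x) * enorm (g x))).
Proof.
move=> a0 bT; have [K hK] := pev_closing_lipschitz p.
have sub : `]a, b] `<=` `[0, T] by apply: subset_itv; rewrite bnd_simp.
apply: (@integrableMr _ _ _ mu _ (mI a b) (fun x => pev p (c x))
  (EFin \o (fun x => enorm (g x)))); last exact: (arclen_itv gint).
  have mc := lipschitz_measurable (ltW T0) hK.
  by apply: measurable_funS mc; [exact: measurable_itv|exact: sub].
exists (`|pev p (c 0)| + `|K| * T); split; first exact: num_real.
move=> B hB x /sub /=; rewrite in_itv /= => /andP[x0 xT]; apply: ltW.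
apply: le_lt_trans hB; rewrite -[pev p (c x)](subrK (pev p (c 0))) addrC.
rewrite (le_trans (ler_normD _ _)) // lerD2l.
rewrite (le_trans (hK _ _ _ _)) ?in_itv /= ?x0 ?xT ?lexx ?(ltW T0) //.
rewrite subr0 ger0_norm // (le_trans (ler_norm _)) // normrM ler_wpM2l //.
by rewrite ger0_norm.
Qed.

(** On a piece of length L / M the integrand deviates from its value at the left end by at most C L
    / M. The M pieces together cost C L^2 / M, and the normalization divides by L. *)
Lemma riemann_sum (p : mpoly n R) (C : R) (M : nat) (theta : nat -> R) :
  (0 < M)%N -> 0 <= C ->
  (forall a b, 0 <= a -> a <= b -> b <= T ->
    `|pev p (c b) - pev p (c a)| <= C * arclen a b) ->
  [/\ theta 0%N = 0, theta M = T,
      forall j, (j <= M)%N -> 0 <= theta j <= T,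
      forall j, (j < M)%N -> theta j <= theta j.+1 &
      forall j, (j < M)%N -> arclen (theta j) (theta j.+1) = L / M%:R] ->
  `|L^-1 * (\int[mu]_(x in `]0, T]) (pev p (c x) * enorm (g x)))%R -
    M%:R^-1 * \sum_(j < M) pev p (c (theta j))| <= C * L / M%:R.
Proof.
move=> M0 C0 hC [th0 thM thI thle tha].
have MR : 0 < M%:R :> R by rewrite ltr0n.
have L0 : 0 < L by rewrite -curve_length_arclen; case: hgamma.
pose J k : R := (\int[mu]_(x in `]0, theta k]) (pev p (c x) * enorm (g x)))%R.
have step k : (k < M)%N ->
    `|J k.+1 - J k - pev p (c (theta k)) * (L / M%:R)| <= C * (L / M%:R) ^+ 2.
  move=> kM; have /andP[t0 tT] := thI k (ltnW kM).
  have /andP[u0 uT] := thI k.+1 kM; have tu := thle k kM.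
  rewrite /J (@Rintegral_itvB _ _ (BRight 0) (BRight (theta k.+1)) (theta k));
    [|exact: pev_closing_integrable|by rewrite bnd_simp|by rewrite bnd_simp].
  rewrite -(tha k kM) /arclen -RintegralZl; [|exact: mI|exact: (arclen_itv gint)].
  have ci : mu.-integrable `]theta k, theta k.+1]
      (EFin \o (fun x => pev p (c (theta k)) * enorm (g x))).
    exact: (@integrableZl _ _ _ mu _ (mI _ _) _ _ (arclen_itv gint t0 uT)).
  rewrite -RintegralB; [|exact: mI|exact: pev_closing_integrable|exact: ci].
  apply: (le_trans (le_normr_Rintegral _ _)); first exact: mI.
    have := integrableB (mI _ _) (pev_closing_integrable p t0 uT) ci.
    by [].
  rewrite expr2 mulrA -RintegralZl; [|exact: mI|exact: (arclen_itv gint)].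
  apply: le_Rintegral; first exact: mI.
  - apply: integrable_norm.
    exact: (integrableB (mI _ _) (pev_closing_integrable p t0 uT) ci).
  - exact: (@integrableZl _ _ _ mu _ (mI _ _) _ _ (arclen_itv gint t0 uT)).
  move=> x; rewrite /= in_itv /= => /andP[tx xu].
  rewrite -mulrBl normrM [X in _ * X]ger0_norm ?enorm_ge0 // ler_wpM2r ?enorm_ge0 //.
  have xT := le_trans xu uT.
  rewrite (le_trans (hC _ _ t0 (ltW tx) xT)) // ler_wpM2l //.
  apply: (@le_trans _ _ (arclen (theta k) (theta k.+1))) => //.
  by rewrite (arclenD gint t0 (ltW tx) xu uT) lerDl arclen_ge0.
have main k : (k <= M)%N ->
    `|J k - (L / M%:R) * \sum_(j < k) pev p (c (theta j))| <=
    k%:R * (C * (L / M%:R) ^+ 2).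
  elim: k => [_|k IH kM].
    by rewrite big_ord0 mulr0 mul0r subr0 /J th0 set_itvoc0 Rintegral_set0 normr0.
  have := step k kM; have := IH (ltnW kM); rewrite big_ord_recr /=.
  set s := \sum_(j < k) _; set e := C * _; set q := pev p _.
  move=> h1 h2; have -> : J k.+1 - L / M%:R * (s + q) =
    (J k.+1 - J k - q * (L / M%:R)) + (J k - L / M%:R * s) by ring.
  by rewrite (le_trans (ler_normD _ _)) // -[k.+1%:R]natr1 [leRHS]mulrDl mul1r [leRHS]addrC lerD.
have := main M (leqnn M); rewrite /J thM.
set A := (X in `|X - _| <= _ -> _); set s := \sum_(j < M) _ => h.
have -> : L^-1 * A - M%:R^-1 * s = L^-1 * (A - L / M%:R * s).
  by field; rewrite !gt_eqF.
rewrite normrM ger0_norm ?invr_ge0 ?(ltW L0) // mulrC ler_pdivrMr //.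
apply: le_trans h _; rewrite le_eqVlt; apply/orP; left; apply/eqP.
by field; rewrite gt_eqF.
Qed.

End Sampling.

(** A summary of the curve in discrete terms, after which no analysis on the curve is needed. The
    points close up to a cycle, and the quadrature constant depends on [p] but not on [M]. *)
Lemma curve_sampling (R : realType) (d : nat) (gamma : R -> 'rV[R]_d.+1) :
  closed_lipschitz_curve gamma -> exists x : nat -> nat -> 'rV[R]_d.+1,
  [/\ forall M j, (0 < M)%N -> (j <= M)%N -> sphere R d (x M j),
      forall M, (0 < M)%N -> x M M = x M 0%N,
      forall (I : finType) (F : I -> mpoly d.+1 R) (B : R), 0 <= B ->
        (forall x v, sphere R d x -> dotv x v = 0 ->
          \sum_a dird (F a) x v ^+ 2 <= B * dotv v v) ->
        forall M j, (0 < M)%N -> (j < M)%N ->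
        \sum_i (pev (F i) (x M j.+1) - pev (F i) (x M j)) ^+ 2 <=
          B * (curve_length gamma / M%:R) ^+ 2 &
      forall p, exists2 C, 0 <= C & forall M, (0 < M)%N ->
        `|(curve_length gamma)^-1 *
            (\int[lebesgue_measure]_(s in `[0, (2 * pi)[)
               (pev p (gamma s) * speed gamma s))%R -
          M%:R^-1 * \sum_(j < M) pev p (x M j)| <= C / M%:R].
Proof.
move=> hg; have [g [gint gder]] := closing_density hg.
have /choice [theta ht] (M : nat) : exists theta : nat -> R, (0 < M)%N ->
  [/\ theta 0%N = 0, theta M = 2 * pi,
      forall j, (j <= M)%N -> 0 <= theta j <= 2 * pi,
      forall j, (j < M)%N -> theta j <= theta j.+1 &
      forall j, (j < M)%N ->
        arclen g (theta j) (theta j.+1) = arclen g 0 (2 * pi) / M%:R].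
  have [M0|_] := ltnP 0 M; last by exists (fun=> 0).
  by have [theta h] := sample_points hg gint gder M0; exists theta.
exists (fun M j => closing gamma (theta M j)); split.
- move=> M j M0 jM; have [_ _ h _ _] := ht M M0.
  by have /andP[t0 _] := h j jM; exact: closing_sphere.
- move=> M M0; have [-> -> _ _ _] := ht M M0.
  by rewrite /closing ltxx; case: ifP.
- move=> I F B B0 hB M j M0 jM; have [_ _ h hle ha] := ht M M0.
  rewrite (curve_length_arclen gint gder) -(ha j jM).
  have /andP[t0 _] := h j (ltnW jM); have /andP[_ tT] := h j.+1 jM.
  by apply: (feature_arclen hg gint gder) => //; exact: hle.
- move=> p; have [C C0 hC] := pev_closing_arclen hg gint gder p.
  exists (C * curve_length gamma) => [|M M0].
    by rewrite mulr_ge0 //; case: hg => _ _ _ /ltW.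
  rewrite (integral_speed gder); last first.
    exact: (pev_closing_integrable hg gint).
  rewrite (curve_length_arclen gint gder).
  by apply: riemann_sum => //; exact: ht.
Qed.

(** * The Laplacian of a cycle *)

Section TrigSums.
Context {R : realType}.
Implicit Types x : R.

Lemma sin_period x q : sin (x + 2 * pi * q%:R) = sin x.
Proof.
rewrite -[RHS](periodicn (@sinD2pi R) q) -mulr_natr mulr2n.
by congr sin; ring.
Qed.

Lemma cos_period x q : cos (x + 2 * pi * q%:R) = cos x.
Proof.
rewrite -[RHS](periodicn (@cosD2pi R) q) -mulr_natr mulr2n.
by congr cos; ring.
Qed.

Lemma sum_cos_closed x m : 2 * sin (x / 2) * \sum_(j < m) cos (x * j%:R) =
  sin (x * m%:R - x / 2) + sin (x / 2).
Proof.
elim: m => [|m IH].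
  by rewrite big_ord0 mulr0 mulr0 sub0r sinN addNr.
rewrite big_ord_recr /= mulrDr IH.
have -> : x * m.+1%:R - x / 2 = x * m%:R + x / 2 by rewrite -natr1; field.
rewrite sinB sinD; ring.
Qed.

Lemma sum_sin_closed x m : 2 * sin (x / 2) * \sum_(j < m) sin (x * j%:R) =
  cos (x / 2) - cos (x * m%:R - x / 2).
Proof.
elim: m => [|m IH].
  by rewrite big_ord0 mulr0 mulr0 sub0r cosN subrr.
rewrite big_ord_recr /= mulrDr IH.
have -> : x * m.+1%:R - x / 2 = x * m%:R + x / 2 by rewrite -natr1; field.
rewrite cosB cosD; ring.
Qed.

Variable M : nat.
Hypothesis M0 : (0 < M)%N.

Let MR : 0 < M%:R :> R. Proof. by rewrite ltr0n. Qed.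

Definition freq (q : nat) : R := 2 * pi * q%:R / M%:R.

Let sin_freq_gt0 q : (0 < q < M)%N -> 0 < sin (freq q / 2).
Proof.
move=> /andP[q0 qM]; apply: sin_gt0_pi.
have -> : freq q / 2 = pi * (q%:R / M%:R) by rewrite /freq; field; rewrite gt_eqF.
rewrite mulr_gt0 ?pi_gt0 ?divr_gt0 ?ltr0n //=.
by rewrite gtr_pMr ?pi_gt0 // ltr_pdivrMr // mul1r ltr_nat.
Qed.

Let freqM q : freq q * M%:R = 2 * pi * q%:R.
Proof. by rewrite /freq divfK // gt_eqF. Qed.

Lemma sum_cos_freq q : (0 < q < M)%N -> \sum_(j < M) cos (freq q * j%:R) = 0.
Proof.
move=> hq; have s0 := sin_freq_gt0 hq.
have := sum_cos_closed (freq q) M.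
rewrite freqM [X in sin X + _]addrC sin_period sinN addNr.
by move/eqP; rewrite mulf_eq0 mulf_eq0 pnatr_eq0 (gt_eqF s0) /= => /eqP.
Qed.

(** The range up to [M.*2] covers the sum of two mode numbers in [mode_orth]; frequencies matter
    only modulo [M]. *)
Lemma sum_sin_freq q : (q < M.*2)%N -> \sum_(j < M) sin (freq q * j%:R) = 0.
Proof.
move=> q2; wlog qM : q q2 / (q < M)%N.
  move=> h; have [|Mq] := ltnP q M; first exact: h.
  rewrite -[RHS](h (q - M)%N); [|lia|lia].
  apply: eq_bigr => j _; rewrite -[RHS](sin_period _ j); congr sin.
  by rewrite /freq natrB //; field; rewrite gt_eqF.
have [->|q0] := eqVneq q 0%N.
  by rewrite big1 // => j _; rewrite /freq mulr0 !mul0r sin0.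
have hq : (0 < q < M)%N by rewrite qM lt0n q0.
have s0 := sin_freq_gt0 hq.
have := sum_sin_closed (freq q) M.
rewrite freqM [X in _ - cos X]addrC cos_period cosN subrr.
by move/eqP; rewrite mulf_eq0 mulf_eq0 pnatr_eq0 (gt_eqF s0) /= => /eqP.
Qed.

(* Hartley's kernel: the discrete Fourier transform with respect to the
   functions [cas = cos + sin] is real, orthogonal and symmetric. *)
Definition cas (x : R) := cos x + sin x.

Definition mode (k j : nat) : R := cas (freq k * j%:R).

Lemma mode_orth (k l : 'I_M) :
  \sum_(j < M) mode k j * mode l j = M%:R * (k == l)%:R.
Proof.
wlog kl : k l / (l <= k)%N.
  move=> h; case: (leqP l k) => [|/ltnW] kl; first exact: h.
  by rewrite eq_sym -(h l k kl); apply: eq_bigr => j _; rewrite mulrC.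
(* The product formula cas a cas b = cos (a - b) + sin (a + b). *)
have -> : \sum_(j < M) mode k j * mode l j =
    \sum_(j < M) (cos (freq (k - l) * j%:R) + sin (freq (k + l) * j%:R)).
  apply: eq_bigr => j _; rewrite /mode /cas.
  have -> : freq (k - l) * j%:R = freq k * j%:R - freq l * j%:R.
    by rewrite /freq natrB //; field; rewrite gt_eqF.
  have -> : freq (k + l) * j%:R = freq k * j%:R + freq l * j%:R.
    by rewrite /freq natrD //; field; rewrite gt_eqF.
  rewrite cosB sinD; ring.
rewrite big_split /= sum_sin_freq ?addr0; last first.
  by have := ltn_ord k; have := ltn_ord l; lia.
have [->|kl'] := eqVneq k l.
  rewrite subnn mulr1; under eq_bigr do rewrite /freq mulr0 !mul0r cos0.
  by rewrite sumr_const card_ord.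
rewrite mulr0 sum_cos_freq //.
have : nat_of_ord k != l by [].
by have := ltn_ord k; lia.
Qed.

(** For a square matrix, orthogonality of the rows gives that of the columns. *)
Lemma mode_complete (i j : 'I_M) :
  \sum_(k < M) mode k i * mode k j = M%:R * (i == j)%:R.
Proof.
pose U : 'M[R]_M := \matrix_(k, j) mode k j.
have hU : U *m (M%:R^-1 *: U^T) = 1%:M.
  apply/matrixP => k l; rewrite -scalemxAr !mxE.
  rewrite (eq_bigr (fun j : 'I_M => mode k j * mode l j)) => [|a _].
    by rewrite mode_orth mulKf ?lt0r_neq0.
  by rewrite !mxE.
have /matrixP /(_ i j) := mulmx1C hU; rewrite -scalemxAl !mxE => h.
rewrite -h mulrA divff ?gt_eqF // mul1r; apply: eq_bigr => k _.
by rewrite !mxE.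
Qed.

Definition coef (u : 'I_M -> R) (k : nat) : R :=
  M%:R^-1 * \sum_(j < M) u j * mode k j.

Lemma mode_norm (k : 'I_M) : M%:R^-1 * \sum_(j < M) mode k j ^+ 2 = 1.
Proof.
under eq_bigr do rewrite expr2.
by rewrite mode_orth eqxx mulr1 mulVf // gt_eqF.
Qed.

Lemma parseval (u w : 'I_M -> R) :
  \sum_(k < M) coef u k * coef w k = M%:R^-1 * \sum_(j < M) u j * w j.
Proof.
have n0 : M%:R != 0 :> R by rewrite gt_eqF.
transitivity (M%:R^-1 ^+ 2 * \sum_(i < M) \sum_(j < M)
   (\sum_(k < M) mode k i * mode k j) * (u i * w j)).
  rewrite mulr_sumr.
  under [RHS]eq_bigr do rewrite mulr_sumr.
  under [RHS]eq_bigr do under eq_bigr do rewrite mulr_suml mulr_sumr.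
  under [RHS]eq_bigr do rewrite exchange_big.
  rewrite exchange_big; apply: eq_bigr => k _ /=.
  rewrite /coef mulrACA -expr2 big_distrl mulr_sumr; apply: eq_bigr => i _ /=.
  by rewrite big_distrr mulr_sumr; apply: eq_bigr => j _ /=; ring.
under eq_bigr do under eq_bigr do rewrite mode_complete.
rewrite expr2 -mulrA; congr (_ * _); rewrite mulr_sumr; apply: eq_bigr => i _.
rewrite (bigD1 i) //= eqxx big1 ?addr0 => [|j ji]; first by rewrite mulr1 mulKf.
by rewrite eq_sym (negbTE ji) mulr0 mul0r.
Qed.

Lemma mode_ordS (k : nat) (j : 'I_M) : mode k (ordS j) = mode k j.+1.
Proof.
rewrite /mode /=; have [jM|jM] := ltnP j.+1 M; first by rewrite modn_small.
have -> : j.+1 = M by have := ltn_ord j; lia.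
rewrite modnn mulr0 /cas freqM -(sin_period 0 k) -(cos_period 0 k).
by rewrite !add0r.
Qed.

(** The eigenvalue 4 sin^2 (pi k / M) of the Laplacian of the M-cycle. *)
Definition lapl (k : nat) : R := 2 - 2 * cos (freq k).

Lemma mode_shift (k : nat) (j : 'I_M) :
  mode k (ordS j) + mode k (ord_pred j) = (2 - lapl k) * mode k j.
Proof.
set i := ord_pred j; have ij : ordS i = j by exact: ord_predK.
have e : mode k j = mode k i.+1 by rewrite -{1}ij mode_ordS.
have aux x : cas (x + freq k) + cas (x - freq k) = 2 * cos (freq k) * cas x.
  by rewrite /cas cosD cosB sinD sinB; ring.
have -> : 2 - lapl k = 2 * cos (freq k) by rewrite /lapl; ring.
have -> : mode k i = cas (freq k * j%:R - freq k).
  have [j0|j0] := posnP j.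
    have -> : nat_of_ord i = M.-1.
      by rewrite /i /= j0 add0n modn_small // prednK.
    rewrite j0 /mode -subn1 natrB // mulrBr mulr1 freqM /cas.
    have -> : 2 * pi * k%:R - freq k = freq k * 0%:R - freq k + 2 * pi * k%:R.
      by ring.
    by rewrite sin_period cos_period.
  have -> : nat_of_ord i = j.-1.
    have e1 : ((j + M).-1 = j.-1 + M)%N by rewrite -{1}(prednK j0).
    rewrite /i /= e1 modnDr modn_small //.
    exact: leq_ltn_trans (leq_pred _) (ltn_ord j).
  by rewrite /mode -subn1 natrB // mulrBr mulr1.
rewrite mode_ordS -aux; congr (_ + _); rewrite /mode -natr1; congr cas; ring.
Qed.

(** The Laplacian is self-adjoint: reindexing the cycle moves the shifts from [u] to the mode, an
    eigenvector by [mode_shift]. *)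
Lemma coef_shift (u : 'I_M -> R) (k : nat) :
  coef (fun j => 2 * u j - u (ordS j) - u (ord_pred j)) k = lapl k * coef u k.
Proof.
rewrite /coef [RHS]mulrCA; congr (_ * _).
under eq_bigr do rewrite !mulrBl.
rewrite !sumrB.
rewrite [X in _ - X - _](_ : _ = \sum_(j < M) u j * mode k (ord_pred j)).
  rewrite [X in _ - X](_ : _ = \sum_(j < M) u j * mode k (ordS j)).
    rewrite -!sumrB mulr_sumr; apply: eq_bigr => j _.
    have := mode_shift k j => h.
    have -> : lapl k * (u j * mode k j) =
        2 * u j * mode k j - u j * ((2 - lapl k) * mode k j) by ring.
    by rewrite -h; ring.
  rewrite [RHS](reindex_inj (@ord_pred_inj M)); apply: eq_bigr => j _.
  by rewrite ord_predK.
rewrite [RHS](reindex_inj (@ordS_inj M)); apply: eq_bigr => j _.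
by rewrite ordSK.
Qed.

Lemma energy_modes (u : 'I_M -> R) :
  M%:R^-1 * \sum_(j < M) (u (ordS j) - u j) ^+ 2 =
  \sum_(k < M) lapl k * coef u k ^+ 2.
Proof.
transitivity (M%:R^-1 * \sum_(j < M) u j * (2 * u j - u (ordS j) - u (ord_pred j))).
  congr (_ * _).
  have -> : \sum_(j < M) u j * (2 * u j - u (ordS j) - u (ord_pred j)) =
     \sum_(j < M) (u j ^+ 2 - u j * u (ordS j)) +
     \sum_(j < M) (u j ^+ 2 - u j * u (ord_pred j)).
    by rewrite -big_split; apply: eq_bigr => j _ /=; ring.
  rewrite [X in _ = _ + X](reindex_inj (@ordS_inj M)) -big_split /=.
  by apply: eq_bigr => j _; rewrite ordSK; ring.
rewrite -parseval; apply: eq_bigr => k _.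
by rewrite coef_shift expr2 mulrCA.
Qed.

Lemma lapl_ge0 k : 0 <= lapl k.
Proof. by have := cos_le1 (freq k); rewrite /lapl; lra. Qed.

Lemma lapl_rev k : (k <= M)%N -> lapl (M - k) = lapl k.
Proof.
move=> kM; rewrite /lapl -[in RHS]cosN -[in RHS](cos_period _ 1).
by congr (_ - _ * cos _); rewrite /freq natrB //; field; rewrite gt_eqF.
Qed.

(** The eigenvalues increase up to M / 2 and are symmetric under k -> M - k. *)
Lemma lapl_le f k : (f <= k)%N -> (k <= M - f)%N -> lapl f <= lapl k.
Proof.
move=> fk kM; wlog k2 : k fk kM / (k.*2 <= M)%N.
  move=> h; have [|kM2] := leqP k.*2 M; first exact: h.
  by rewrite -[leRHS]lapl_rev; [apply: h; lia|lia].
have freq_pi q : (q.*2 <= M)%N -> freq q \in `[0, pi].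
  move=> q2; rewrite in_itv /=; apply/andP; split.
    by rewrite /freq divr_ge0 ?mulr_ge0 ?pi_ge0.
  have h : 2 * q%:R <= M%:R :> R by rewrite -natrM mul2n ler_nat.
  rewrite /freq ler_pdivrMr // mulrAC mulrC; apply: ler_wpM2l h.
  exact: pi_ge0.
have ff : freq f <= freq k.
  by rewrite /freq ler_pM2r ?invr_gt0 // ler_wpM2l ?mulr_ge0 ?pi_ge0 // ler_nat.
have : cos (freq k) <= cos (freq f).
  rewrite leNgt ltr_cos -?leNgt //; apply: freq_pi => //.
  by apply: leq_trans k2; rewrite leq_double.
by rewrite /lapl; lra.
Qed.

Lemma ler_sum_surj (I J : finType) (f : J -> R) (kappa : I -> J) :
  (forall k, 0 <= f k) -> (forall k, f k != 0 -> exists i, kappa i = k) ->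
  \sum_k f k <= \sum_i f (kappa i).
Proof.
move=> f0 fs; rewrite (partition_big kappa xpredT) //=; apply: ler_sum => k _.
have [->|fk] := eqVneq (f k) 0; first by apply: sumr_ge0.
have [i <-] := fs k fk; rewrite (bigD1 i) //= lerDl.
by apply: sumr_ge0.
Qed.

(* The sums of the coefficients squared are at most [1 + delta] in each mode and
   add up to [N], so the energy is at least that of the [N] lowest modes, which
   have the frequencies 0, 1, 1, 2, 2, and so on. *)
Lemma trace_lower (I : finType) (psi : I -> 'I_M -> R) (N : nat) (delta : R) :
  (N < M)%N -> 0 <= delta ->
  M%:R^-1 * \sum_(j < M) \sum_a psi a j ^+ 2 = N%:R ->
  (forall k : 'I_M, \sum_a coef (psi a) k ^+ 2 <= 1 + delta) ->
  \sum_(i < N) lapl (uphalf i) - delta * N%:R * lapl N./2 <=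
  M%:R^-1 * \sum_(j < M) \sum_a (psi a (ordS j) - psi a j) ^+ 2.
Proof.
move=> NM d0 trN tau1; pose tau (k : 'I_M) := \sum_a coef (psi a) k ^+ 2.
have tau0 k : 0 <= tau k by apply: sumr_ge0 => a _; exact: sqr_ge0.
have -> : M%:R^-1 * \sum_(j < M) \sum_a (psi a (ordS j) - psi a j) ^+ 2 =
    \sum_k lapl (nat_of_ord k) * tau k.
  rewrite exchange_big mulr_sumr.
  under eq_bigr do rewrite energy_modes.
  by rewrite exchange_big; apply: eq_bigr => k _; rewrite mulr_sumr.
have tauN : \sum_k tau k = N%:R.
  rewrite -trN /tau exchange_big [in RHS]exchange_big mulr_sumr; apply: eq_bigr => a _.
  rewrite (eq_bigr (fun k : 'I_M => coef (psi a) k * coef (psi a) k)) => [|k _].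
    by rewrite parseval; congr (_ * _); apply: eq_bigr.
  by rewrite expr2.
(* [F] is the highest frequency among the [N] lowest modes. With [lapl F] as threshold, a mode below
   it can lower the energy by at most [pos k] times its capacity [1 + delta]. *)
set F := N./2; pose pos (k : 'I_M) := Num.max (lapl F - lapl k) 0.
have pos0 k : 0 <= pos k by rewrite /pos le_max lexx orbT.
have e0 : \sum_k lapl (nat_of_ord k) * tau k >=
    lapl F * N%:R - (1 + delta) * \sum_k pos k.
  rewrite -tauN !mulr_sumr -sumrB; apply: ler_sum => k _.
  have h1 : (lapl F - lapl k) * tau k <= pos k * tau k.
    by rewrite ler_wpM2r // /pos le_max lexx.
  have h2 : pos k * tau k <= pos k * (1 + delta) by rewrite ler_wpM2l // tau1.
  by lra.
(* The modes in the order 0, 1, M - 1, 2, M - 2, ... of increasing eigenvalue; the remainder modulo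
   [M] matters for [i = 0] only, where it turns M into 0. *)
pose kn i := ((if odd i then uphalf i else M - i./2) %% M)%N.
have knM i : (kn i < M)%N by rewrite ltn_pmod.
have laplk (i : 'I_N) : lapl (kn i) = lapl (uphalf i).
  rewrite /kn; have iN := ltn_ord i; case: ifP => oi.
    by rewrite modn_small // uphalf_half oi; lia.
  rewrite uphalf_half oi add0n; have [->|i0] := eqVneq i./2 0%N.
    by rewrite subn0 modnn.
  rewrite modn_small ?lapl_rev //; lia.
have uF (i : 'I_N) : (uphalf i <= F)%N by rewrite /F; have := ltn_ord i; lia.
have lF (i : 'I_N) : lapl (uphalf i) <= lapl F.
  by apply: lapl_le => //; have := ltn_ord i; rewrite /F; lia.
have e1 : \sum_k pos k <= \sum_(i < N) (lapl F - lapl (uphalf i)).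
  have -> : \sum_(i < N) (lapl F - lapl (uphalf i)) =
      \sum_(i < N) pos (Ordinal (knM i)).
    by apply: eq_bigr => i _; rewrite /pos /= laplk max_l // subr_ge0.
  apply: (ler_sum_surj (f := pos) (kappa := fun i : 'I_N => Ordinal (knM i))) => // k pk.
  have kM := ltn_ord k.
  have hk : (k < F)%N || (M - F < k)%N.
    apply: contraNT pk; rewrite negb_or -!leqNgt => /andP[Fk kF].
    by rewrite /pos max_r // subr_le0 lapl_le.
  case/orP: hk => hk.
    have [k0|k0] := posnP k.
      have N0 : (0 < N)%N by rewrite /F in hk; lia.
      by exists (Ordinal N0); apply/val_inj; rewrite /= /kn /= subn0 modnn k0.
    have iN : ((k.-1).*2.+1 < N)%N by rewrite /F in hk; lia.
    exists (Ordinal iN); apply/val_inj; rewrite /= /kn /= odd_double /=.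
    rewrite half_double.
    by rewrite prednK // modn_small.
  have iN : ((M - k).*2 < N)%N by rewrite /F in hk; lia.
  exists (Ordinal iN); apply/val_inj; rewrite /= /kn /= odd_double /= half_double.
  by rewrite subKn ?modn_small // ltnW.
have e2 : \sum_(i < N) (lapl F - lapl (uphalf i)) =
    N%:R * lapl F - \sum_(i < N) lapl (uphalf i).
  by rewrite sumrB sumr_const card_ord mulr_natl.
have e3 : 0 <= \sum_(i < N) lapl (uphalf i) by apply: sumr_ge0 => i _; exact: lapl_ge0.
apply: le_trans e0.
have : (1 + delta) * \sum_k pos k <=
    (1 + delta) * (N%:R * lapl F - \sum_(i < N) lapl (uphalf i)).
  by rewrite ler_wpM2l ?addr_ge0 // -e2.
have : 0 <= delta * \sum_(i < N) lapl (uphalf i) by exact: mulr_ge0.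
by lra.
Qed.

End TrigSums.

(** * Bessel's inequality for averages over samples *)

Section SampledBessel.
Context {R : realType} (M : nat).
Hypothesis M0 : (0 < M)%N.
Implicit Types u w : 'I_M -> R.

Definition avg u : R := M%:R^-1 * \sum_(j < M) u j.

Lemma eq_avg u w : u =1 w -> avg u = avg w.
Proof. by move=> uw; rewrite /avg; congr (_ * _); apply: eq_bigr. Qed.

Lemma avgD u w : avg (fun j => u j + w j) = avg u + avg w.
Proof. by rewrite /avg big_split mulrDr. Qed.

Lemma avgZ c u : avg (fun j => c * u j) = c * avg u.
Proof. by rewrite /avg -mulr_sumr mulrCA. Qed.

Lemma avg_sum (I : finType) (f : I -> 'I_M -> R) :
  avg (fun j => \sum_a f a j) = \sum_a avg (f a).
Proof. by rewrite /avg exchange_big mulr_sumr. Qed.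

Lemma le_avg u w : (forall j, u j <= w j) -> avg u <= avg w.
Proof. by move=> uw; rewrite ler_wpM2l ?invr_ge0 // ler_sum. Qed.

Lemma avg_CauchySchwarz u w :
  avg (fun j => u j * w j) ^+ 2 <= avg (fun j => u j ^+ 2) * avg (fun j => w j ^+ 2).
Proof.
rewrite /avg exprMn [leRHS]mulrACA -[_^-1 * _^-1]expr2.
rewrite ler_wpM2l ?sqr_ge0 //.
exact: sum_CauchySchwarz.
Qed.

Lemma ler_mul_sqr (a b x delta : R) : `|x| <= delta ->
  a * b * x <= delta / 2 * (a ^+ 2 + b ^+ 2).
Proof.
move=> xd; have h : `|a * b| <= (a ^+ 2 + b ^+ 2) / 2.
  have := sqr_ge0 (a - b); have := sqr_ge0 (a + b).
  by rewrite ler_norml !expr2; lra.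
apply: le_trans (ler_norm _) _; rewrite normrM.
have -> : delta / 2 * (a ^+ 2 + b ^+ 2) = (a ^+ 2 + b ^+ 2) / 2 * delta by ring.
by rewrite ler_pM.
Qed.

(** Each of the errors in the Gram matrix is weighted by a product of two coefficients, at most the
    mean of their squares. *)
Lemma gram_bound (I : finType) (f : I -> 'I_M -> R) (delta : R) (A : I -> R) :
  (forall a b, `|avg (fun j => f a j * f b j) - (a == b)%:R| <= delta) ->
  avg (fun j => (\sum_a A a * f a j) ^+ 2) <=
  (1 + delta * #|I|%:R) * \sum_a A a ^+ 2.
Proof.
move=> hf.
have -> : avg (fun j => (\sum_a A a * f a j) ^+ 2) =
    \sum_a \sum_b A a * A b * avg (fun j => f a j * f b j).
  rewrite (eq_avg (w := fun j => \sum_a \sum_b A a * A b * (f a j * f b j))).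
    rewrite avg_sum; apply: eq_bigr => a _.
    by rewrite avg_sum; apply: eq_bigr => b _; rewrite avgZ.
  move=> j; rewrite expr2 big_distrl; apply: eq_bigr => a _ /=.
  by rewrite big_distrr; apply: eq_bigr => b _ /=; ring.
apply: (@le_trans _ _ (\sum_a \sum_b (A a * A b * (a == b)%:R +
    delta / 2 * (A a ^+ 2 + A b ^+ 2)))).
  apply: ler_sum => a _; apply: ler_sum => b _.
  have := ler_mul_sqr (A a) (A b) (hf a b).
  by rewrite mulrBr; lra.
rewrite le_eqVlt; apply/orP; left; apply/eqP.
under eq_bigr do rewrite big_split /=.
rewrite big_split /= mulrDl mul1r; congr (_ + _).
  apply: eq_bigr => a _; rewrite (bigD1 a) //= eqxx mulr1 big1 ?addr0 ?expr2 //.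
  by move=> b ba; rewrite eq_sym (negbTE ba) mulr0.
under eq_bigr do rewrite -mulr_sumr big_split /= sumr_const.
rewrite -mulr_sumr big_split /= sumrMnl sumr_const.
set s := \sum_a _; rewrite -[s *+ _]mulr_natr.
by field.
Qed.

(* The [g b * y c] need not be orthonormal, but a combination of them has norm at
   most that of its coefficients, by Cauchy-Schwarz over [c] at every point. *)
Lemma sampled_bessel (I J K : finType) (f : I -> 'I_M -> R) (g : J -> 'I_M -> R)
    (y : K -> 'I_M -> R) (e : 'I_M -> R) (delta : R) : 0 <= delta ->
  (forall a b, `|avg (fun j => f a j * f b j) - (a == b)%:R| <= delta) ->
  (forall a b, `|avg (fun j => g a j * g b j) - (a == b)%:R| <= delta) ->
  (forall a b c, `|avg (fun j => f a j * (g b j * y c j))| <= delta) ->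
  (forall j, \sum_c y c j ^+ 2 = 1) ->
  avg (fun j => e j ^+ 2) = 1 ->
  \sum_a avg (fun j => f a j * e j) ^+ 2 +
  \sum_b \sum_c avg (fun j => g b j * y c j * e j) ^+ 2 <=
  1 + delta * (#|I| + #|J| + #|J| * #|K|)%:R.
Proof.
move=> d0 hf hg hfg hy he.
pose A a := avg (fun j => f a j * e j).
pose B b c := avg (fun j => g b j * y c j * e j).
pose tA := \sum_a A a ^+ 2; pose tB := \sum_b \sum_c B b c ^+ 2.
rewrite -/tA -/tB; set tau := tA + tB.
pose p j := \sum_a A a * f a j; pose q c j := \sum_b B b c * g b j.
(* The combination of the features whose coefficients are those of [e] itself: its average against
   [e] is [tau], so [tau ^+ 2] is at most the mean square of [v], and this is at most [X * tau]. *)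
pose v j := p j + \sum_c q c j * y c j.
have tA0 : 0 <= tA by apply: sumr_ge0 => a _; exact: sqr_ge0.
have tB0 : 0 <= tB.
  by apply: sumr_ge0 => b _; apply: sumr_ge0 => c _; exact: sqr_ge0.
have ve : avg (fun j => v j * e j) = tau.
  rewrite (eq_avg (w := fun j => (\sum_a A a * (f a j * e j)) +
     \sum_b \sum_c B b c * (g b j * y c j * e j))).
    rewrite avgD !avg_sum; congr (_ + _).
      by apply: eq_bigr => a _; rewrite avgZ -expr2.
    apply: eq_bigr => b _; rewrite avg_sum; apply: eq_bigr => c _.
    by rewrite avgZ -expr2.
  move=> j; rewrite /v mulrDl; congr (_ + _).
    by rewrite /p big_distrl; apply: eq_bigr => a _ /=; rewrite mulrA.
  rewrite exchange_big big_distrl; apply: eq_bigr => c _ /=.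
  rewrite /q !big_distrl; apply: eq_bigr => b _ /=; ring.
have tau2 : tau ^+ 2 <= avg (fun j => v j ^+ 2).
  by rewrite -ve; apply: le_trans (avg_CauchySchwarz _ _) _; rewrite he mulr1.
have hp : avg (fun j => p j ^+ 2) <= (1 + delta * #|I|%:R) * tA.
  exact: gram_bound.
have hq : avg (fun j => (\sum_c q c j * y c j) ^+ 2) <=
    (1 + delta * #|J|%:R) * tB.
  apply: (@le_trans _ _ (avg (fun j => \sum_c q c j ^+ 2))).
    apply: le_avg => j; apply: le_trans (sum_CauchySchwarz _ _) _.
    by rewrite hy mulr1.
  rewrite avg_sum /tB exchange_big mulr_sumr; apply: ler_sum => c _.
  exact: gram_bound.
have hpq : 2 * avg (fun j => p j * \sum_c q c j * y c j) <=
    delta * ((#|J| * #|K|)%:R * tA + #|I|%:R * tB).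
  rewrite (eq_avg (w := fun j =>
      \sum_a \sum_b \sum_c A a * B b c * (f a j * (g b j * y c j)))); last first.
    move=> j; rewrite /p big_distrl; apply: eq_bigr => a _ /=.
    rewrite exchange_big mulr_sumr; apply: eq_bigr => c _ /=.
    by rewrite /q big_distrl mulr_sumr; apply: eq_bigr => b _ /=; ring.
  rewrite avg_sum; under eq_bigr do rewrite avg_sum.
  under eq_bigr do under eq_bigr do rewrite avg_sum.
  apply: (@le_trans _ _ (2 * \sum_a \sum_b \sum_c
      (delta / 2 * (A a ^+ 2 + B b c ^+ 2)))).
    rewrite ler_wpM2l //; apply: ler_sum => a _; apply: ler_sum => b _.
    by apply: ler_sum => c _; rewrite avgZ; exact: ler_mul_sqr.
  rewrite le_eqVlt; apply/orP; left; apply/eqP.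
  under eq_bigr do under eq_bigr do rewrite -mulr_sumr big_split /= sumr_const.
  under eq_bigr do rewrite -mulr_sumr big_split /= sumr_const.
  rewrite -mulr_sumr big_split /= sumr_const -/tB.
  rewrite !sumrMnl -mulrnA -/tA -[tA *+ _]mulr_natl -[tB *+ _]mulr_natl mulnC.
  by field.
have : avg (fun j => v j ^+ 2) = avg (fun j => p j ^+ 2) +
    2 * avg (fun j => p j * \sum_c q c j * y c j) +
    avg (fun j => (\sum_c q c j * y c j) ^+ 2).
  by rewrite -avgZ -!avgD; apply: eq_avg => j; rewrite /v; ring.
set X := 1 + _ => vE; have : tau ^+ 2 <= X * tau.
  apply: le_trans tau2 _; rewrite vE.
  have h1 : 0 <= delta * #|J|%:R * tA by rewrite !mulr_ge0.
  have h2 : 0 <= delta * (#|J| * #|K|)%:R * tB by rewrite !mulr_ge0.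
  by rewrite /X /tau !natrD; lra.
have tau0 : 0 <= tau by exact: addr_ge0.
have [->|tn0] := eqVneq tau 0; first by rewrite addr_ge0 // mulr_ge0.
by rewrite expr2 ler_pM2r // lt0r tn0.
Qed.

End SampledBessel.

(** The difference quotients of [sin (a * s)] at 0, along the steps [1 / n.+1]. *)
Lemma cvg_natr_sin (R : realType) (a : R) :
  n.+1%:R * sin (a / n.+1%:R) @[n --> \oo] --> a.
Proof.
have d : is_derive (0 : R) 1 (fun s => sin (a * s)) a.
  have h : is_derive (0 : R) 1 (fun s : R => a * s) a.
    by apply: is_derive_eq; rewrite /GRing.scale /=; ring.
  apply: is_derive_eq; rewrite mulr0 cos0 /GRing.scale /=; ring.
have dl : h^-1 *: (sin (a * (h *: 1 + 0)) - sin (a * 0)) @[h --> (0 : R)^'] --> a.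
  by rewrite -[X in _ --> X](@derive_val _ _ _ _ _ _ _ d); exact: ex_derive.
apply/cvgrPdist_le => e e0.
move/cvgrPdist_le : dl => /(_ _ e0)[/= r r0] hr.
near=> n; have u0 : (n.+1%:R : R)^-1 != 0 by rewrite invr_eq0 pnatr_eq0.
have := hr n.+1%:R^-1; rewrite /= mulr0 sin0 subr0 addr0 invrK.
rewrite /GRing.scale /= mulr1; apply => //.
rewrite sub0r normrN gtr0_norm ?invr_gt0 ?ltr0n //.
near: n; have := @cvg_harmonic R.
move=> /cvgrPdist_lt /(_ _ r0); apply: filterS => n /=.
by rewrite sub0r normrN gtr0_norm ?invr_gt0 ?ltr0n.
Unshelve. all: by end_near. Qed.

(** The rescaled eigenvalue is 4 (M sin (pi k / M))^2; its limit is an eigenvalue of the circle of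
    length 1. *)
Lemma cvg_natr_lapl (R : realType) (k : nat) :
  n.+1%:R ^+ 2 * (lapl n.+1 k : R) @[n --> \oo] --> (2 * pi * k%:R : R) ^+ 2.
Proof.
have -> : (fun n => n.+1%:R ^+ 2 * lapl n.+1 k) =
    (fun n => 4 * (n.+1%:R * sin (pi * k%:R / n.+1%:R)) ^+ 2) :> (nat -> R).
  apply/funext => n; rewrite /lapl.
  have -> : freq n.+1 k = (pi * k%:R / n.+1%:R) *+ 2 :> R.
    by rewrite /freq -mulr_natr; ring.
  by rewrite cos_mulr2n cos2sin2; ring.
rewrite [X in _ --> X](_ : _ = 4 * (pi * k%:R) ^+ 2); last by ring.
by apply: cvgMl_tmp; rewrite expr2; under eq_fun do rewrite expr2; apply: cvgM; exact: cvg_natr_sin.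
Qed.

(** * The lower bound for the length *)

Lemma homog_msize_le (R : nzRingType) (n k : nat) (p : mpoly n R) :
  p \is ishomog1 k mdeg -> (msize p <= k.+1)%N.
Proof.
move=> /dhomogP hp; rewrite msizeE; apply/bigmax_leqP_seq => m mp _.
by rewrite ltnS -(hp m mp).
Qed.

(** Makes the quadrature constant uniform over the finitely many products of features. *)
Lemma choice_bound (R : realDomainType) (I : finType) (P : I -> R -> Prop) :
  (forall i C D, C <= D -> P i C -> P i D) ->
  (forall i, exists2 C, 0 <= C & P i C) ->
  exists2 C, 0 <= C & forall i, P i C.
Proof.
move=> mono ex; have /choice [C hC] i : exists C, 0 <= C /\ P i C.
  by have [C C0 PC] := ex i; exists C.
exists (\sum_i C i) => [|i]; first by apply: sumr_ge0 => i _; exact: (hC i).1.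
apply: mono (hC i).2; rewrite (bigD1 i) //= lerDl.
by apply: sumr_ge0 => j _; exact: (hC j).1.
Qed.

Section LengthBound.
Context {R : realType} {d : nat} (sigma : probability (borel_rV R d) R).
Hypothesis hd : (1 <= d)%N.
Hypothesis hsigma : is_uniform_sphere sigma.
Local Notation n := d.+1.
Variables (t : nat) (gamma : R -> 'rV[R]_n).
Hypothesis hgamma : design_curve sigma t gamma.
Notation S := (sphere R d).
Local Notation L := (curve_length gamma).

Let i0 : 'I_n := Ordinal (ltn0Sn d).
Let i1 : 'I_n := @Ordinal d.+1 1 hd.
Let i01 : i0 != i1. Proof. by []. Qed.

Definition energy_const (k : nat) : nat := n * 'C(k + n, n.+1).

(* Both parities of t in one statement: the second family of features is [g b * y c]
   with [g b] an orthonormal basis in degree [k2], and [y] is constant for t even and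
   lists the coordinates for t odd. *)
Lemma design_curve_length (k1 k2 e kappa : nat) (J : finType)
    (y : J -> mpoly n R) :
  (k1 + k1 <= t)%N -> (k2 + k2 <= t)%N -> (k1 + (k2 + e) <= t)%N ->
  odd (k1 + (k2 + e)) ->
  (forall c, y c \is ishomog1 e mdeg) ->
  (forall x, S x -> \sum_c pev (y c) x ^+ 2 = 1) ->
  (forall x v, S x -> dotv x v = 0 ->
     \sum_c pev (y c) x * dird (y c) x v = 0) ->
  (forall x v, S x -> dotv x v = 0 ->
     \sum_c dird (y c) x v ^+ 2 = kappa%:R * dotv v v) ->
  \sum_(i < size (mons n k1) + size (mons n k2)) (2 * pi * (uphalf i)%:R) ^+ 2 <=
  (energy_const k1 + energy_const k2 + kappa * size (mons n k2))%:R * L ^+ 2.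
Proof.
move=> t1 t2 t12 odd12 yhom ysq ytan yen.
set N := addn (size _) _.
pose B := (energy_const k1 + energy_const k2 + kappa * size (mons n k2))%N.
have [G1 G1u G1o] := orthonormal_hbasis hsigma k1.
have [G2 G2u G2o] := orthonormal_hbasis hsigma k2.
pose N1 := size (mons n k1); pose N2 := size (mons n k2).
pose f : 'I_N1 -> mpoly n R := hbasis G1; pose g : 'I_N2 -> mpoly n R := hbasis G2.
pose F (s : 'I_N1 + 'I_N2 * J) : mpoly n R :=
  match s with inl a => f a | inr bc => g bc.1 * y bc.2 end.
have sumF (h : 'I_N1 + 'I_N2 * J -> R) :
    \sum_s h s = \sum_a h (inl a) + \sum_b \sum_c h (inr (b, c)).
  by rewrite big_sumType /= pair_bigA; congr (_ + _); apply: eq_bigr => -[].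
have hcurve := hgamma.1.
have L0 : 0 < L by case: hcurve.
have [x [xS xM xF xp]] := curve_sampling hcurve.
have quad (p : mpoly n R) k : p \is ishomog1 k mdeg -> (k <= t)%N ->
    exists2 C, 0 <= C & forall M, (0 < M)%N ->
      `|M%:R^-1 * \sum_(j < M) pev p (x M j) - spoly sigma p| <= C / M%:R.
  move=> hp kt; have [C C0 hC] := xp p; exists C => // M M0.
  rewrite distrC; have -> : spoly sigma p = L^-1 *
      (\int[lebesgue_measure]_(s in `[0, (2 * pi)%R[)
         (pev p (gamma s) * speed gamma s))%R.
    apply: hgamma.2; exists p => //.
    by apply: leq_trans (homog_msize_le hp) _.
  exact: hC.
have quad2 (I1 I2 : finType) (u : I1 -> mpoly n R) (w : I2 -> mpoly n R) ku kw :
    (forall a, u a \is ishomog1 ku mdeg) -> (forall b, w b \is ishomog1 kw mdeg) ->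
    (ku + kw <= t)%N ->
    exists2 C, 0 <= C & forall a b M, (0 < M)%N ->
      `|avg (fun j : 'I_M => pev (u a) (x M j) * pev (w b) (x M j)) -
        spoly sigma (u a * w b)| <= C / M%:R.
  move=> hu hw kt.
  have [|ab|C C0 hC] := @choice_bound R (I1 * I2)%type (fun ab C =>
      forall M, (0 < M)%N ->
      `|avg (fun j : 'I_M => pev (u ab.1) (x M j) * pev (w ab.2) (x M j)) -
        spoly sigma (u ab.1 * w ab.2)| <= C / M%:R).
  - move=> ab C D CD h M M0; apply: le_trans (h M M0) _.
    by rewrite ler_wpM2r ?invr_ge0.
  - have [C C0 hC] := quad _ _ (dhomogM (hu ab.1) (hw ab.2)) kt.
    exists C => // M M0; apply: le_trans (hC M M0).
    by rewrite /avg; under eq_bigr do rewrite -pevM.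
  by exists C => // a b M M0; exact: (hC (a, b)).
have fhom a : f a \is ishomog1 k1 mdeg by exact: hbasis_homog.
have ghom b : g b \is ishomog1 k2 mdeg by exact: hbasis_homog.
have [C1 C10 hC1] := quad2 _ _ f f _ _ fhom fhom t1.
have [C2 C20 hC2] := quad2 _ _ g g _ _ ghom ghom t2.
have gyhom (bc : 'I_N2 * J) : g bc.1 * y bc.2 \is ishomog1 (k2 + e) mdeg.
  exact: dhomogM.
have [C3 C30 hC3] :=
  quad2 _ _ f (fun bc : 'I_N2 * J => g bc.1 * y bc.2) _ _ fhom gyhom t12.
pose C := C1 + C2 + C3; have C0 : 0 <= C by rewrite !addr_ge0.
have CM M c : (0 < M)%N -> 0 <= c -> c <= C -> c / M%:R <= C / M%:R.
  by move=> M0 c0 cC; rewrite ler_wpM2r ?invr_ge0.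
pose K : R := (N1 + N2 + N2 * #|J|)%:R.
have main M : (N < M)%N ->
    \sum_(i < N) lapl M (uphalf i) - (C / M%:R * K) * N%:R * lapl M N./2 <=
    B%:R * (L / M%:R) ^+ 2.
  move=> NM; have M0 : (0 < M)%N by apply: leq_ltn_trans NM.
  have MR : 0 < M%:R :> R by rewrite ltr0n.
  pose psi (s : 'I_N1 + 'I_N2 * J) (j : 'I_M) := pev (F s) (x M j).
  have Sx (j : 'I_M) : S (x M j) by apply: xS => //; exact: ltnW.
  have CM0 : 0 <= C / M%:R by rewrite divr_ge0.
  apply: le_trans (trace_lower (psi := psi) M0 NM _ _ _) _.
  - by rewrite mulr_ge0.
  (* The trace condition holds without error, as the squared features add up to [N] at each sample
     point. *)
  - rewrite (eq_bigr (fun=> N%:R)) => [|j _].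
      by rewrite sumr_const card_ord -[N%:R *+ M]mulr_natl mulKf ?gt_eqF.
    rewrite sumF /psi /= natrD; congr (_ + _); first exact: (kernel_diag hsigma).
    under eq_bigr do under eq_bigr do rewrite pevM exprMn.
    under eq_bigr do rewrite -mulr_sumr ysq // mulr1.
    exact: (kernel_diag hsigma).
  - move=> k; pose ek (j : 'I_M) : R := mode M k j.
    have := @sampled_bessel R M _ _ _ (fun a (j : 'I_M) => pev (f a) (x M j))
      (fun b (j : 'I_M) => pev (g b) (x M j)) (fun c (j : 'I_M) => pev (y c) (x M j))
      ek (C / M%:R) CM0.
    rewrite !card_ord -/K => bes; rewrite sumF.
    apply: le_trans (bes _ _ _ _ _).
    + rewrite lerD //; apply: ler_sum => b _; apply: ler_sum => c _.
      by rewrite /psi /coef /avg /=; under eq_bigr do rewrite pevM.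
    + move=> a b; rewrite -G1o; apply: le_trans (hC1 a b M M0) _.
      by apply: CM => //; rewrite /C; lra.
    + move=> a b; rewrite -G2o; apply: le_trans (hC2 a b M M0) _.
      by apply: CM => //; rewrite /C; lra.
    + move=> a b c; have := hC3 a (b, c) M M0.
      rewrite (spoly_odd hsigma (dhomogM (fhom a) (gyhom (b, c))) odd12) subr0.
      have -> : avg (fun j : 'I_M => pev (f a) (x M j) * pev (g b * y c) (x M j)) =
          avg (fun j : 'I_M => pev (f a) (x M j) *
            (pev (g b) (x M j) * pev (y c) (x M j))).
        by apply: eq_avg => j; rewrite pevM.
      by move=> /le_trans; apply; apply: CM => //; rewrite /C; lra.
    + by move=> j; apply: ysq.
    + exact: mode_norm.
  rewrite -[leRHS](mulKf (lt0r_neq0 MR)) ler_wpM2l ?invr_ge0 ?(ltW MR) //.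
  set D := B%:R * _; rewrite mulr_natl -[X in _ *+ X](card_ord M) -sumr_const.
  apply: ler_sum => j _; rewrite {}/D.
  have -> : \sum_s (psi s (ordS j) - psi s j) ^+ 2 =
      \sum_s (pev (F s) (x M j.+1) - pev (F s) (x M j)) ^+ 2.
    suff e' : x M (ordS j) = x M j.+1 by rewrite /psi e'.
    rewrite /=; have [jM|jM] := ltnP j.+1 M; first by rewrite modn_small.
    have -> : j.+1 = M by have := ltn_ord j; lia.
    by rewrite modnn -xM.
  apply: xF => // z v Sz zv.
  rewrite sumF (kernel_energy hsigma i01 G1u G1o Sz zv).
  have -> : \sum_b \sum_c dird (F (inr (b, c))) z v ^+ 2 =
      \sum_b (dird (g b) z v ^+ 2 + pev (g b) z ^+ 2 * (kappa%:R * dotv v v)).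
    apply: eq_bigr => b _; rewrite -(yen z v Sz zv).
    under eq_bigr do rewrite dirdM.
    move: (dird (g b) z v) (pev (g b) z) => D P.
    (* The square of the derivative of [g b * y c] is expanded; summed over [c], the cross term
       vanishes by [ytan]. *)
    rewrite [in RHS](_ : D ^+ 2 = D ^+ 2 * \sum_c pev (y c) z ^+ 2 +
        2 * P * D * \sum_c pev (y c) z * dird (y c) z v); last first.
      by rewrite ysq // ytan // mulr1 mulr0 addr0.
    rewrite !mulr_sumr -!big_split; apply: eq_bigr => c _ /=.
    by ring.
  rewrite big_split /= (kernel_energy hsigma i01 G2u G2o Sz zv) -mulr_suml.
  rewrite (kernel_diag hsigma G2u G2o Sz) /B /energy_const !natrD !natrM.
  by rewrite le_eqVlt; apply/orP; left; apply/eqP; ring.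
(* After multiplication by the square of the number of samples the eigenvalues converge, and the
   error term keeps the factor 1 / M that comes from [delta]. *)
have lim : \sum_(i < N) m.+1%:R ^+ 2 * (lapl m.+1 (uphalf i) : R) -
    C * K * N%:R * (m.+1%:R^-1 * (m.+1%:R ^+ 2 * lapl m.+1 N./2)) @[m --> \oo] -->
    \sum_(i < N) (2 * pi * (uphalf i)%:R : R) ^+ 2 -
    C * K * N%:R * (0 * (2 * pi * (N./2)%:R) ^+ 2).
  apply: cvgB.
    apply: (cvg_big add_continuous) => i _; exact: cvg_natr_lapl.
  by apply: cvgMl_tmp; apply: cvgM; [exact: cvg_harmonic|exact: cvg_natr_lapl].
have : \sum_(i < N) (2 * pi * (uphalf i)%:R : R) ^+ 2 -
    C * K * N%:R * (0 * (2 * pi * (N./2)%:R) ^+ 2) <= B%:R * L ^+ 2.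
  apply: (cvgr_to_le lim); exists N => // m /= Nm.
  have m0 : m.+1%:R != 0 :> R by rewrite pnatr_eq0.
  have := main m.+1 Nm; rewrite -(ler_pM2l (exprn_gt0 2 (_ : 0 < m.+1%:R))) ?ltr0n //.
  rewrite mulrBr mulr_sumr => h.
  have -> : B%:R * L ^+ 2 = m.+1%:R ^+ 2 * (B%:R * (L / m.+1%:R) ^+ 2) by field.
  apply: le_trans h; rewrite le_eqVlt; apply/orP; left; apply/eqP.
  by congr (_ - _); field.
by rewrite mul0r mulr0 subr0.
Qed.

End LengthBound.

(** The origin of the denominator d + 2 in [Btd], cleared here so as to stay within the natural
    numbers. *)
Lemma energy_constE (d k : nat) :
  (d.+2 * @energy_const d k = (k + d.+1) * k * 'C(k + d, d))%N.
Proof.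
rewrite /energy_const mulnCA -mul_bin_diag addnS /= mulnCA mul_bin_left.
by rewrite addnK mulnA.
Qed.

(** The even case of [Btd], with m shifted by one so that the degree m - 1 needs no truncated
    subtraction. *)
Lemma energy_const_succ (d m : nat) :
  (d.+2 * (@energy_const d m.+1 + @energy_const d m) =
   m.+1 * (d + m.+1) * ('C(d + m.+1, d) + 'C(d + m, d)))%N.
Proof.
rewrite mulnDr !energy_constE ![(_ + d)%N]addnC.
have := mul_bin_down (d + m.+1) d; rewrite addnS /= -addnS addKn.
by move: 'C(_, _) 'C(_, _) => u v; nia.
Qed.

(** The constant mode has frequency 0, which turns [N] modes into [N.-1] terms. *)
Lemma sum_uphalf_sqr (N : nat) :
  (\sum_(i < N) uphalf i ^ 2 = \sum_(i < N.-1) i./2.+1 ^ 2)%N.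
Proof. by case: N => [|N]; rewrite ?big_ord0 // big_ord_recl. Qed.

Lemma sqrt_ratio_le (R : rcfType) (A B c L : R) : 0 <= A -> 0 <= B -> 0 <= c ->
  0 <= L -> c ^+ 2 * A <= B * L ^+ 2 -> c * Num.sqrt (A / B) <= L.
Proof.
(* Division by zero yields 0. *)
move=> A0 B0 c0 L0 h; have [->|Bn0] := eqVneq B 0.
  by rewrite invr0 mulr0 sqrtr0 mulr0.
have Bp : 0 < B by rewrite lt_neqAle eq_sym Bn0.
rewrite -ler_sqr ?nnegrE ?mulr_ge0 ?sqrtr_ge0 // exprMn sqr_sqrtr ?divr_ge0 //.
by rewrite mulrA ler_pdivrMr // mulrC [leRHS]mulrC // [_ * c ^+ 2]mulrC.
Qed.

Theorem theorem4 (R : realType) (t d : nat) (ht : (1 <= t)%N) (hd : (1 <= d)%N)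
  (sigma : probability (borel_rV R d) R) (hsigma : is_uniform_sphere sigma)
  (gamma : R -> 'rV[R]_d.+1) (hgamma : design_curve sigma t gamma) :
  2 * pi * Num.sqrt ((Atd t d)%:R / Btd R t d) <= curve_length gamma.
Proof.
suff [B BE hB] : exists2 B : nat, Btd R t d = B%:R &
    \sum_(i < Ntd t d) (2 * pi * (uphalf i)%:R) ^+ 2 <=
    B%:R * curve_length gamma ^+ 2.
  have [_ _ _ L0] := hgamma.1.
  rewrite BE; apply: sqrt_ratio_le => //; rewrite ?mulr_ge0 ?pi_ge0 ?(ltW L0) //.
  apply: le_trans hB; rewrite /Atd -sum_uphalf_sqr natr_sum mulr_sumr.
  by apply: ler_sum => i _; rewrite natrX -exprMn.
have d2 : (d + 2)%:R != 0 :> R by rewrite addn2 pnatr_eq0.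
rewrite /Ntd /Btd; have := odd_double_half t; set m := t./2.
case: ifP => _ /=; last first.
  rewrite add0n => tm; have [k mk] : exists k, m = k.+1.
    by exists m.-1; rewrite prednK //; move: ht tm; lia.
  rewrite mk addnS subn1 /= -addnS.
  exists (energy_const (d := d) k.+1 + energy_const (d := d) k)%N.
    apply: (mulfI d2); rewrite mulrA mulrCA mulfV // mulr1 -!natrM.
    by rewrite -energy_const_succ addn2.
  have := design_curve_length hd hsigma hgamma (k1 := k.+1) (k2 := k) (e := 0)
    (kappa := 0) (J := unit) (y := fun=> 1).
  rewrite !size_mons mul0n !addn0 ![(_ + d)%N]addnC; apply=> //.
  - by move: tm; rewrite mk; lia.
  - by move: tm; rewrite mk; lia.
  - by move: tm; rewrite mk; lia.
  - by lia.
  - by move=> _; exact: dhomog1.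
  - by move=> x _; rewrite big_const card_unit /= pev1 expr1n addr0.
  - by move=> x v _ _; rewrite big1 // => c _; rewrite dird1 mulr0.
  - by move=> x v _ _; rewrite big1 ?mul0r // => c _; rewrite dird1 expr0n.
rewrite add1n => tm.
(* The last summand is the energy of the coordinate factors, where [kappa] is 1 since the squared
   derivatives of the coordinates along [v] add up to [dotv v v]; it accounts for the summand 1 in
   the odd case of [Btd]. *)
exists (energy_const (d := d) m + energy_const (d := d) m + 1 * 'C(d + m, d))%N.
  apply: (mulfI d2); rewrite mulrCA mulrDr mulr1 mulrCA mulfV // mulr1.
  rewrite -natrD -!natrM; congr _%:R.
  have := energy_constE d m; rewrite addn2 ![(m + _)%N]addnC.
  by move: 'C(_, _) (energy_const _) => u v; nia.
have := design_curve_length hd hsigma hgamma (k1 := m) (k2 := m) (e := 1)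
  (kappa := 1) (y := fun c : 'I_d.+1 => mpolyX R (mnm1 c)).
rewrite !size_mons ![(_ + d)%N]addnC (addnn 'C(_, _)) -mul2n; apply=> //.
- by move: tm; lia.
- by move: tm; lia.
- by move: tm; lia.
- by lia.
- by move=> c; rewrite dhomogX; apply/eqP; exact: mdeg1.
- move=> x /sphereP xx; rewrite -[RHS]xx dotvE; apply: eq_bigr => c _.
  by rewrite pevX expr2.
- move=> x v _ xv; rewrite -[RHS]xv dotvE; apply: eq_bigr => c _.
  by rewrite pevX dirdX.
- move=> x v _ _; rewrite mul1r dotvE; apply: eq_bigr => c _.
  by rewrite dirdX expr2.
Qed.
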